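(* There exist absolute constants $c, c', C>0$ (not depending on $n,p,\sigma,\beta^*,M,t$) such that the following holds. For any $t>0$, if \[ \sigma\leq\frac{p\log n+t}{n}\le c,\qquad M \geq \frac{n}{p\log n + t}, \] then, with probability at least $1-6\exp(-t)$, \[ \|\hat{\beta}-\beta^*\|_2\le C\, \frac{p\log n + t}{n}\quad\text{and}\quad \hat{\tau}\ge c'\, \frac{n}{p\log n + t}. \]
   Context: Let $n,p$ be positive integers with $p<n$, $\sigma>0$, and $\beta^*\in S^{p-1}=\{\beta\in\mathbb{R}^p:\|\beta\|_2=1\}$. Let $x\sim\mathcal N(0,I_p)$ and $\epsilon\sim\mathcal N(0,1)$ be independent, and $y=\mathrm{sign}(x^T\beta^*+\sigma\epsilon)\in\{-1,1\}$ (the null event where the argument is $0$ is ignored). The data $(x_1,y_1),\dots,(x_n,y_n)$ are i.i.d. copies of $(x,y)$. $\log$ is the natural logarithm. For $M>0$ let $B_M=\{\gamma\in\mathbb{R}^p:\|\gamma\|_2\le M\}$. The constrained logistic regression estimator $\hat\gamma$ is a solution of \[ \min_{\gamma\in B_M}\sum_{i=1}^n\log(1+\exp(-y_ix_i^T\gamma)). \] Write $\hat\tau=\|\hat\gamma\|_2$ and $\hat\beta=\hat\gamma/\|\hat\gamma\|_2$ (almost surely $\hat\gamma\ne0$). *)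

(* Defs.v *)
From HB Require Import structures.
From mathcomp Require Import all_boot all_order all_algebra.
From mathcomp Require Import all_classical all_reals all_analysis.

Set Implicit Arguments.
Unset Strict Implicit.
Unset Printing Implicit Defensive.

Import Order.TTheory GRing.Theory Num.Theory.
Import numFieldNormedType.Exports.

Local Open Scope classical_set_scope.
Local Open Scope ring_scope.

Definition dot (R : realType) (p : nat) (u v : 'rV[R]_p) : R :=
  \sum_(j < p) u 0 j * v 0 j.

(* The library norm `|u| on 'rV[R]_p is the sup norm, hence this definition. *)
Definition l2norm (R : realType) (p : nat) (u : 'rV[R]_p) : R :=
  Num.sqrt (\sum_(j < p) u 0 j ^+ 2).

(* Random vectors take values in p.-tuple R, which carries the product (Borel)
   sigma-algebra; vec moves them to the vector space 'rV[R]_p. *)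
Definition vec (R : realType) (p : nat) (x : p.-tuple R) : 'rV[R]_p :=
  \row_(j < p) tnth x j.

(* Restricted to measurable sets: a measure is a function on all of set T, with
   unspecified values outside the sigma-algebra. *)
Definition eq_law (d : measure_display) (T : measurableType d) (R : realType)
    (mu nu : set T -> \bar R) : Prop :=
  forall A : set T, measurable A -> mu A = nu A.

Definition independent_pair (d d1 d2 : measure_display) (T : measurableType d)
    (E1 : measurableType d1) (E2 : measurableType d2) (R : realType)
    (P : probability T R) (X : T -> E1) (Y : T -> E2) : Prop :=
  forall (A : set E1) (B : set E2), measurable A -> measurable B ->
    P (X @^-1` A `&` Y @^-1` B) = (P (X @^-1` A) * P (Y @^-1` B))%E.

(* The product rule over the whole family suffices: taking A i = setT outside
   a subset of indices gives the rule for every subfamily. *)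
Definition mutually_independent (d d' : measure_display) (T : measurableType d)
    (E : measurableType d') (R : realType) (P : probability T R) (n : nat)
    (X : 'I_n -> T -> E) : Prop :=
  forall A : 'I_n -> set E, (forall i, measurable (A i)) ->
    P (\bigcap_i (X i @^-1` A i)) = (\prod_(i < n) P (X i @^-1` A i))%E.

Definition std_normal (d : measure_display) (T : measurableType d)
    (R : realType) (P : probability T R) (X : T -> R) : Prop :=
  eq_law (pushforward P X) (normal_prob 0 1).

Definition std_normal_vector (d : measure_display) (T : measurableType d)
    (R : realType) (P : probability T R) (p : nat) (x : T -> p.-tuple R) : Prop :=
  mutually_independent P (fun (j : 'I_p) w => tnth (x w) j) /\
  forall j : 'I_p, std_normal P (fun w => tnth (x w) j).

(* z = (x, y) with y = sign(x^T beta + sigma eps).  Num.sg 0 = 0, so the label is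
   constrained only almost surely. *)
Definition sign_model (d : measure_display) (T : measurableType d)
    (R : realType) (P : probability T R) (p : nat) (sigma : R)
    (beta : 'rV[R]_p) (eps : {RV P >-> R})
    (z : {RV P >-> (p.-tuple R * R)%type}) : Prop :=
  [/\ std_normal_vector P (fun w => (z w).1),
      std_normal P eps,
      independent_pair P (fun w => (z w).1) eps &
      {ae P, forall w,
        (z w).2 = Num.sg (dot (vec (z w).1) beta + sigma * eps w)}].

Definition iid_copies (d0 d d' : measure_display) (T0 : measurableType d0)
    (T : measurableType d) (E : measurableType d') (R : realType)
    (P0 : probability T0 R) (P : probability T R) (n : nat)
    (z : {RV P0 >-> E}) (Z : 'I_n -> {RV P >-> E}) : Prop :=
  mutually_independent P (fun i => Z i : T -> E) /\
  forall i : 'I_n, eq_law (distribution P (Z i)) (distribution P0 z).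

Definition logistic_loss (R : realType) (n p : nat)
    (z : 'I_n -> p.-tuple R * R) (gamma : 'rV[R]_p) : R :=
  \sum_(i < n) ln (1 + expR (- (z i).2 * dot (vec (z i).1) gamma)).

Definition constrained_logistic_solution (R : realType) (n p : nat) (M : R)
    (z : 'I_n -> p.-tuple R * R) (gamma : 'rV[R]_p) : Prop :=
  l2norm gamma <= M /\
  forall gamma' : 'rV[R]_p, l2norm gamma' <= M ->
    logistic_loss z gamma <= logistic_loss z gamma'.

(* For measurable E this is q <= P E; in general it bounds the inner
   probability, so that an estimator need not be a measurable selection. *)
Definition with_probability_at_least (d : measure_display)
    (T : measurableType d) (R : realType) (P : probability T R) (q : R)
    (E : set T) : Prop :=
  exists A : set T, [/\ measurable A, A `<=` E & (q%:E <= P A)%E].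

(* Main.v *)
Require Import Defs.
From HB Require Import structures.
From mathcomp Require Import all_boot all_order all_algebra.
From mathcomp Require Import all_classical all_reals all_analysis.
From mathcomp Require Import measurable_realfun.
From mathcomp Require Import ring lra zify.

Set Implicit Arguments.
Unset Strict Implicit.
Unset Printing Implicit Defensive.

Import Order.TTheory GRing.Theory Num.Theory.
Import numFieldNormedType.Exports.

Local Open Scope classical_set_scope.
Local Open Scope ring_scope.

(** Why the theorem holds.  Write e = p ln n + t and delta = e / n, so that
    sigma <= delta, and compare the estimator with the feasible vector
    delta^-1 *: beta.

    The reference loss is O(n delta) (reference_loss_event).  The label can
    disagree with the sign of u = x . beta only if |u| <= sigma |eps|, so that
    always - y u <= - |u| + 2 sigma |eps|.  Hence the exponential of the loss of
    one sample has mean at most 1 + E exp (- |u| / delta) E exp (2 |eps|), which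
    is 1 + O(delta) because u has a bounded density.  By independence and
    Markov's inequality (iid_chernoff) the total loss exceeds a multiple of
    n delta with probability at most exp (- n delta) <= exp (- t).

    Any vector violating one of the two claims has a larger loss, by a
    deterministic argument (low_loss_localizes) from two counting statements,
    uniform over unit vectors b:
    - near: at least Q n delta / 4 samples have y (x . b) = O(delta).  Each
      costs at least ln (1 + exp (- 1)) if the norm of the vector is below a
      small multiple of 1 / delta, so the norm of the estimator is not.
    - far: if the distance of b to beta is at least 4 A delta, then at least
      Q n delta / 4 samples have y (x . b) <= - (A - 1) delta.  With a norm of
      order 1 / delta each of them costs at least 1, so the direction of the
      estimator is not that far.

    For a fixed b, the probability of such a margin event is bounded from below
    by sign_model_near_margin and sign_model_wrong_margin, which only need the
    joint law of (x . beta, x . b): a standard normal s and c s + g t with t an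
    independent standard normal.  This law is gaussian_pair_law, obtained
    by adding the coordinates of x one by one and restoring the triangular form
    at each step by plane rotations; the rotation invariance of the plane
    Gaussian comes from writing a rotation as three shears.  The counts
    concentrate by iid_chernoff again.  Uniformity costs a union bound over a net
    of at most exp (6 p ln n) points (grid_cover, uniform_margin_count), whose
    mesh is fine enough since the entries of all the x_i are at most n outside
    an event of probability exp (- t) (bounded_design_event).  The term p ln n of
    delta pays for the net.

    Four exceptional events are discarded, which gives 1 - 6 exp (- t) with
    room to spare. *)

(** * Integration against weights, independence and Chernoff bounds *)

Section Weighted.
Local Open Scope ereal_scope.
Context d d' (T : measurableType d) (E : measurableType d') (R : realType).
Import HBNNSimple.

(** The identity passes from indicators to all nonnegative functions by
    linearity and monotone convergence.  With X the identity it is a density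
    formula; with H a function independent of X it says that the mean of a
    product is the product of the means. *)
Lemma ge0_integral_weighted_comp (mu : {measure set T -> \bar R})
    (nu : {measure set E -> \bar R}) (X : T -> E) (H : T -> R) (m : R) :
  (0 <= m)%R -> measurable_fun [set: T] X -> measurable_fun [set: T] H ->
  (forall x, 0 <= H x)%R ->
  (forall A, measurable A ->
     \int[mu]_(x in X @^-1` A) (H x)%:E = m%:E * nu A) ->
  forall f : E -> \bar R, measurable_fun [set: E] f -> (forall x, 0 <= f x) ->
    \int[mu]_x (f (X x) * (H x)%:E) = m%:E * \int[nu]_x f x.
Proof.
move=> m0 mX mH H0 hind f mf f0.
pose h := nnsfun_approx measurableT mf.
have mhX n : measurable_fun setT (h n \o X).
  by apply: measurableT_comp => //; exact: measurable_funP.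
have -> : \int[nu]_x f x = limn (fun n => \int[nu]_x (h n x)%:E).
  rewrite -monotone_convergence//.
  - by apply: eq_integral => x _; apply/esym/cvg_lim => //; exact: cvg_nnsfun_approx.
  - by move=> n; exact/measurable_EFinP.
  - by move=> *; rewrite lee_fin.
  - by move=> x _ a b ab; rewrite lee_fin; exact/lefP/nd_nnsfun_approx.
have -> : \int[mu]_x (f (X x) * (H x)%:E)
          = limn (fun n => \int[mu]_x ((h n (X x))%:E * (H x)%:E)).
  rewrite -monotone_convergence//.
  - apply: eq_integral => x _; apply/esym/cvg_lim => //.
    by apply: cvgeZr => //; exact: cvg_nnsfun_approx.
  - by move=> n; apply: emeasurable_funM; apply/measurable_EFinP => //; exact: mhX.
  - by move=> n x _; rewrite mule_ge0 ?lee_fin.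
  - move=> x _ a b ab; rewrite lee_wpmul2r ?lee_fin//.
    exact/lefP/nd_nnsfun_approx.
rewrite -limeMl//; last first.
  apply: ereal_nondecreasing_is_cvgn => a b ab; apply: ge0_le_integral => //.
  - by move=> x _; rewrite lee_fin.
  - exact/measurable_EFinP.
  - exact/measurable_EFinP.
  - by move=> x _; rewrite lee_fin; exact/lefP/nd_nnsfun_approx.
congr (limn _); apply/funext => n.
have mX1 r : measurable (X @^-1` (h n @^-1` [set r])).
  by rewrite -[X in measurable X]setTI; exact: mX.
transitivity (\int[mu]_x \sum_(y \in range (h n))
     ((y * \1_(h n @^-1` [set y]) (X x))%:E * (H x)%:E)).
  apply: eq_integral => x _; rewrite fimfunE -fsumEFin// ge0_mule_fsuml//.
  by move=> y; rewrite nnfun_muleindic_ge0.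
rewrite ge0_integral_fsum//; last 2 first.
- move=> r; apply: emeasurable_funM; apply/measurable_EFinP => //.
  by apply: measurable_funM => //; apply: measurableT_comp.
- by move=> r x _; rewrite mule_ge0 ?nnfun_muleindic_ge0 ?lee_fin.
transitivity (m%:E * \int[nu]_x \sum_(y \in range (h n))
     (y * \1_(h n @^-1` [set y]) x)%:E); last first.
  by congr (_ * _); apply: eq_integral => x _; rewrite fimfunE -fsumEFin.
rewrite ge0_integral_fsum//; last 2 first.
- by move=> r; apply/measurable_EFinP; exact: measurable_funM.
- by move=> r x _; rewrite nnfun_muleindic_ge0.
rewrite ge0_mule_fsumr; last first.
  by move=> r; apply: integral_ge0 => x _; rewrite nnfun_muleindic_ge0.
apply: eq_fsbigr => r /[!inE] -[z _ hz].
have r0 : (0 <= r)%R by rewrite -hz.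
rewrite integralZl_indic_nnsfun//= integral_indic// setIT muleCA -hind//.
rewrite -ge0_integralZl//; last 2 first.
- by apply/measurable_EFinP; exact: measurable_funTS.
- by move=> x _; rewrite lee_fin.
rewrite [RHS]integral_mkcond; apply: eq_integral => x _.
rewrite patchE indicE.
case: ifPn => [/set_mem hx|/negP hx]; first by rewrite mem_set// mulr1.
by rewrite memNset ?mulr0 ?mul0e// => /mem_set.
Qed.
End Weighted.

Section Independence.
Local Open Scope ereal_scope.
Context d d' (T : measurableType d) (E : measurableType d') (R : realType).

Lemma prod_indic_bigcap n (X : 'I_n -> T -> E) (A : 'I_n -> set E) (w : T) :
  (\prod_(i < n) \1_(A i) (X i w) = \1_(\bigcap_i (X i @^-1` A i)) w :> R)%R.
Proof.
rewrite [RHS]indicE; have [/set_mem h|/negP h] := boolP (w \in _).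
  by apply: big1 => i _; rewrite indicE mem_set//; exact: h.
have [i hi] : exists i, ~ A i (X i w).
  apply: contrapT => /forallNP hA; apply: h; apply/mem_set => i _.
  exact: contrapT (hA i).
by rewrite (bigD1 i)//= indicE memNset// mul0r.
Qed.

(** Independence is given for events only; it extends to functions one
    factor at a time, ge0_integral_weighted_comp being applied with the product
    of the other factors as weight. *)
Lemma integral_prod_independent (P : probability T R) n
    (X : 'I_n -> {RV P >-> E}) (f : 'I_n -> E -> R) (b : 'I_n -> R) :
  mutually_independent P (fun i => X i : T -> E) ->
  (forall i, measurable_fun [set: E] (f i)) -> (forall i x, 0 <= f i x)%R ->
  (forall i, \int[P]_w (f i (X i w))%:E = (b i)%:E) ->
  \int[P]_w (\prod_(i < n) f i (X i w))%:E = (\prod_(i < n) b i)%:E.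
Proof.
move=> indep mf f0 fb.
have b0 i : (0 <= b i)%R.
  by rewrite -lee_fin -fb; apply: integral_ge0 => w _; rewrite lee_fin.
have mXA i B : measurable B -> measurable (X i @^-1` B).
  by move=> mB; rewrite -[X in measurable X]setTI; exact: measurable_funP.
(* The first k factors are already functions, the others still indicators. *)
pose g k (A : 'I_n -> set E) (i : 'I_n) (x : E) : R :=
  if (i < k)%N then f i x else \1_(A i) x.
pose c k (A : 'I_n -> set E) (i : 'I_n) : R :=
  if (i < k)%N then b i else fine (P (X i @^-1` A i)).
have g0 k A i x : (0 <= g k A i x)%R by rewrite /g; case: ifP.
have c0 k A i : (0 <= c k A i)%R by rewrite /c; case: ifP => // _; exact: fine_ge0.
suff claim k : (k <= n)%N -> forall A : 'I_n -> set E, (forall i, measurable (A i)) ->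
    \int[P]_w (\prod_(i < n) g k A i (X i w))%:E = (\prod_(i < n) c k A i)%:E.
  have := claim n (leqnn n) (fun=> setT) (fun=> measurableT).
  by under eq_integral => w _ do under eq_bigr => i _ do rewrite /g ltn_ord;
    under eq_bigr => i _ do rewrite /c ltn_ord.
elim: k => [_ A mA|k IH kn A mA].
  transitivity (\int[P]_w (\1_(\bigcap_i (X i @^-1` A i)) w)%:E).
    by apply: eq_integral => w _; rewrite -prod_indic_bigcap.
  rewrite integral_indic//=; last first.
    by apply: fin_bigcap_measurable => // i _; exact: mXA.
  rewrite setIT indep// -prodEFin; apply: eq_bigr => i _; rewrite /c ltn0.
  by rewrite fineK// fin_num_measure//; exact: mXA.
pose k' := Ordinal kn.
have mg j B i : measurable (B i) -> measurable_fun [set: E] (g j B i).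
  by move=> mB; rewrite /g; case: (i < j)%N => //; exact: measurable_indic.
pose H (w : T) := (\prod_(i < n | i != k') g k.+1 A i (X i w))%R.
pose m := (\prod_(i < n | i != k') c k.+1 A i)%R.
have ltk i : i != k' -> (i < k.+1)%N = (i < k)%N.
  move=> ik; rewrite ltnS leq_eqVlt; suff -> : (i == k :> nat) = false by [].
  by apply: contraNF ik => /eqP e; apply/eqP/val_inj.
pose A' B i := if i == k' then B else A i.
have mA' B : measurable B -> forall i, measurable (A' B i).
  by move=> mB i; rewrite /A'; case: ifP.
have mH : measurable_fun [set: T] H.
  rewrite /H; under eq_fun => w do rewrite -big_filter.
  apply: measurable_prod => i _; apply: measurableT_comp => //; exact: mg.
have H0 w : (0 <= H w)%R by apply: prodr_ge0.
have hind B : measurable B ->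
    \int[P]_(w in X k' @^-1` B) (H w)%:E = m%:E * distribution P (X k') B.
  move=> mB; have := IH (ltnW kn) (A' B) (mA' B mB).
  rewrite [in X in _ = X -> _](bigD1 k')//=.
  rewrite /c ltnn /A' eqxx mulrC EFinM fineK ?fin_num_measure//; last exact: mXA.
  have -> : (\prod_(i < n | i != k')
      (if (i < k)%N then b i else fine (P (X i @^-1` (if i == k' then B else A i)))) = m)%R.
    by apply: eq_bigr => i ik; rewrite /c (ltk _ ik) (negbTE ik).
  move=> <-; rewrite integral_mkcond; apply: eq_integral => w _.
  rewrite (bigD1 k')//= patchE.
  have -> : (\prod_(i < n | i != k') g k (A' B) i (X i w) = H w)%R.
    by apply: eq_bigr => i ik; rewrite /g (ltk _ ik) /A' (negbTE ik).
  rewrite /g ltnn /A' eqxx indicE.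
  case: ifPn => [/set_mem hx|/negP hx]; first by rewrite mem_set// mul1r.
  by rewrite memNset ?mul0r// => /mem_set.
transitivity (\int[P]_w ((f k' (X k' w))%:E * (H w)%:E)).
  by apply: eq_integral => w _; rewrite (bigD1 k')//= EFinM /g ltnSn.
rewrite (ge0_integral_weighted_comp _ _ mH H0 hind (f := fun x => (f k' x)%:E))//.
- rewrite ge0_integral_pushforward//=; last 2 first.
  + exact/measurable_EFinP.
  + by move=> x _; rewrite lee_fin.
  rewrite preimage_setT fb -EFinM mulrC [in RHS](bigD1 k')//=.
  by rewrite /c ltnSn.
- exact: prodr_ge0.
- exact/measurable_EFinP.
- by move=> x; rewrite lee_fin.
Qed.

Lemma markov_ge0 (P : probability T R) (F : T -> R) (a c : R) : (0 < a)%R ->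
  measurable_fun [set: T] F -> (forall w, 0 <= F w)%R ->
  \int[P]_w (F w)%:E <= c%:E -> P [set w | (a <= F w)%R] <= (c / a)%:E.
Proof.
move=> a0 mF F0 Fc; set A := [set w | _].
have mA : measurable A.
  rewrite -[A]setTI; have -> : A = F @^-1` `[a, +oo[.
    by apply/seteqP; split => w /=; rewrite in_itv/= andbT.
  exact: mF.
rewrite mulrC EFinM -lee_pdivrMl ?invr_gt0// invrK.
apply: le_trans Fc; rewrite -integral_cst//.
rewrite integral_mkcond; apply: ge0_le_integral => //.
- by move=> w _; rewrite patchE; case: ifP => // _; rewrite lee_fin ltW.
- by apply/(measurable_restrictT _ mA).1; exact: measurable_cst.
- exact/measurable_EFinP.
- by move=> w _; rewrite patchE; case: ifPn => [/set_mem //|_]; rewrite lee_fin.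
Qed.
End Independence.

Lemma iid_integral d0 d d' (T0 : measurableType d0) (T : measurableType d)
    (E : measurableType d') (R : realType) (P0 : probability T0 R)
    (P : probability T R) n (z : {RV P0 >-> E}) (Z : 'I_n -> {RV P >-> E})
    (h : E -> R) (i : 'I_n) :
  iid_copies z Z -> measurable_fun [set: E] h -> (forall x, 0 <= h x) ->
  (\int[P]_w (h (Z i w))%:E = \int[P0]_w (h (z w))%:E)%E.
Proof.
move=> [_ law] mh h0.
have me : measurable_fun [set: E] (fun x => (h x)%:E) by exact/measurable_EFinP.
have e0 : {in [set: E], forall y, (0 <= (h y)%:E)%E} by move=> x _; rewrite lee_fin.
have mZ := @measurable_funPT _ _ _ _ (Z i).
have mz := @measurable_funPT _ _ _ _ z.
have := ge0_integral_pushforward mZ P measurableT me e0.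
rewrite preimage_setT => <-.
have := ge0_integral_pushforward mz P0 measurableT me e0.
rewrite preimage_setT => <-.
by apply: eq_measure_integral => A mA _; exact: law.
Qed.

(** Markov's inequality for the product, whose mean is at most expR b to
    the power n. *)
Lemma iid_chernoff d0 d d' (T0 : measurableType d0) (T : measurableType d)
    (E : measurableType d') (R : realType) (P0 : probability T0 R)
    (P : probability T R) n (z : {RV P0 >-> E}) (Z : 'I_n -> {RV P >-> E})
    (h : E -> R) (b s : R) :
  iid_copies z Z -> measurable_fun [set: E] h -> (forall x, 0 <= h x) ->
  (\int[P0]_w (h (z w))%:E <= (expR b)%:E)%E ->
  (P [set w | (expR s <= \prod_(i < n) h (Z i w))%R] <= (expR (n%:R * b - s))%:E)%E.
Proof.
move=> iid mh h0 hb; rewrite expRB.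
apply: markov_ge0; [exact: expR_gt0| |by move=> w; apply: prodr_ge0|].
  by apply: measurable_prod => i _; apply: measurableT_comp.
have int0 : (0 <= \int[P0]_w (h (z w))%:E)%E.
  by apply: integral_ge0 => w _; rewrite lee_fin.
have fin : (\int[P0]_w (h (z w))%:E)%E \is a fin_num.
  by rewrite ge0_fin_numE// (le_lt_trans hb)// ltry.
have hi i : (\int[P]_w (h (Z i w))%:E = (fine (\int[P0]_w (h (z w))%:E))%:E)%E.
  by rewrite fineK//; exact: (iid_integral i iid mh h0).
rewrite (integral_prod_independent iid.1 (fun=> mh) (fun=> h0) hi).
rewrite lee_fin expRM_natl prodr_const card_ord lerXn2r// ?nnegrE ?fine_ge0 ?expR_ge0//.
by rewrite -lee_fin fineK.
Qed.

(** * Rotation invariance of the plane Gaussian *)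

Section LebesguePlane.
Local Open Scope ereal_scope.
Context (R : realType).
Local Notation mu := (@lebesgue_measure R).

(** By uniqueness of the Lebesgue measure, since shifting preserves the
    length of intervals. *)
Lemma lebesgue_integral_shift (a : R) (f : R -> \bar R) :
  measurable_fun [set: R] f -> (forall x, 0 <= f x) ->
  \int[mu]_x f (x + a)%R = \int[mu]_x f x.
Proof.
move=> mf f0.
have ms : measurable_fun [set: measurableTypeR R] (fun x : R => (x + a)%R : measurableTypeR R).
  by apply: measurable_funD => //; exact: measurable_cst.
have f0' : {in [set: R], forall y, 0 <= f y} by [].
have := ge0_integral_pushforward ms mu measurableT mf f0'.
rewrite preimage_setT => /esym; rewrite /= => ->.
apply: eq_measure_integral => A mA _.
apply/esym/lebesgue_measure_unique => //= _ [[x y]] _ <-.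
rewrite /pushforward.
have -> : (fun z : R => (z + a)%R) @^-1` `]x, y] = `](x - a)%R, (y - a)%R]%classic.
  by apply/seteqP; split => z /=; rewrite !in_itv/= ltrBlDr lerBrDr.
rewrite !lebesgue_measure_itv/= !lte_fin ltrD2r.
by case: ifP => // _; rewrite -!EFinB; congr EFin; ring.
Qed.

Lemma measurable_fun_plane_map d (U : measurableType d) (F : R * R -> U) (g h : R * R -> R) :
  measurable_fun [set: R * R] F -> measurable_fun [set: R * R] g ->
  measurable_fun [set: R * R] h -> measurable_fun [set: R * R] (fun z => F (g z, h z)).
Proof.
by move=> mF mg mh; apply: (measurableT_comp mF); exact: measurable_fun_pair.
Qed.

Lemma lebesgue_integral_shear2 (k : R) (F : R * R -> \bar R) :
  measurable_fun [set: R * R] F -> (forall z, 0 <= F z) ->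
  \int[mu]_x \int[mu]_y F (x, y + k * x)%R = \int[mu]_x \int[mu]_y F (x, y).
Proof.
move=> mF F0; apply: eq_integral => x _.
apply: (lebesgue_integral_shift _ (f := fun y => F (x, y))) => //.
exact: measurableT_comp.
Qed.

Lemma lebesgue_integral_swap (F : R * R -> \bar R) :
  measurable_fun [set: R * R] F -> (forall z, 0 <= F z) ->
  \int[mu]_x \int[mu]_y F (x, y) = \int[mu]_y \int[mu]_x F (x, y).
Proof. by move=> mF F0; exact: (@fubini_tonelli _ _ _ _ _ mu mu F mF F0). Qed.

Lemma measurable_shear (k : R) :
  measurable_fun [set: R * R] (fun z : R * R => (z.1 + k * z.2)%R) /\
  measurable_fun [set: R * R] (fun z : R * R => (z.2 + k * z.1)%R).
Proof.
by split; apply: measurable_funD => //; apply: measurable_funM => //; exact: measurable_cst.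
Qed.

Lemma lebesgue_integral_shear1 (k : R) (F : R * R -> \bar R) :
  measurable_fun [set: R * R] F -> (forall z, 0 <= F z) ->
  \int[mu]_x \int[mu]_y F (x + k * y, y)%R = \int[mu]_x \int[mu]_y F (x, y).
Proof.
move=> mF F0; apply: etrans (esym (lebesgue_integral_swap mF F0)).
have mF' : measurable_fun [set: R * R] (fun z : R * R => F (z.1 + k * z.2, z.2)%R).
  by apply: measurable_fun_plane_map => //; exact: (measurable_shear k).1.
apply: etrans (lebesgue_integral_swap mF' (fun=> F0 _)) _.
apply: eq_integral => y _ /=.
apply: (lebesgue_integral_shift _ (f := fun x => F (x, y))) => //.
exact: measurableT_comp.
Qed.

(** A rotation by an angle in [- pi/2, pi/2] is the product of three shears,
    with the tangent of the half angle, q / (1 + c), as horizontal coefficient;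
    shears preserve the Lebesgue integral by translation invariance on lines. *)
Lemma lebesgue_integral_rotation (c q : R) (F : R * R -> \bar R) :
  (0 <= c)%R -> (c ^+ 2 + q ^+ 2 = 1)%R ->
  measurable_fun [set: R * R] F -> (forall z, 0 <= F z) ->
  \int[mu]_x \int[mu]_y F (c * x - q * y, q * x + c * y)%R =
  \int[mu]_x \int[mu]_y F (x, y).
Proof.
move=> c0 cq mF F0.
have c1 : (1 + c != 0)%R by rewrite gt_eqF// ltr_pwDl.
pose k := (- (q / (1 + c)))%R.
pose F1 (z : R * R) := F (z.1 + k * z.2, z.2)%R.
pose F2 (z : R * R) := F1 (z.1, z.2 + q * z.1)%R.
have mF1 : measurable_fun [set: R * R] F1.
  by apply: measurable_fun_plane_map => //; exact: (measurable_shear k).1.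
have mF2 : measurable_fun [set: R * R] F2.
  by apply: measurable_fun_plane_map => //; exact: (measurable_shear q).2.
have F10 z : 0 <= F1 z by exact: F0.
have F20 z : 0 <= F2 z by exact: F0.
apply: etrans (lebesgue_integral_shear1 k mF F0).
apply: etrans (lebesgue_integral_shear2 q mF1 F10).
apply: etrans (lebesgue_integral_shear1 k mF2 F20).
apply: eq_integral => x _; apply: eq_integral => y _.
have kq : (q * k = c - 1)%R.
  apply: (mulIf c1); rewrite /k mulrN mulNr -!mulrA mulVf// mulr1.
  have -> : (q * q = 1 - c ^+ 2)%R by rewrite -cq; ring.
  by ring.
have kc : (k * (1 + c) = - q)%R by rewrite /k mulNr divfK.
have qkc : (1 + q * k = c)%R by rewrite kq; ring.
rewrite /F2 /F1 /=; congr (F (_, _)).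
  transitivity ((1 + q * k) * x + k * (1 + (1 + q * k)) * y)%R; last by ring.
  by rewrite qkc kc mulNr.
transitivity (q * x + (1 + q * k) * y)%R; last by ring.
by rewrite qkc.
Qed.

End LebesguePlane.

Ltac measurable_affine :=
  repeat match goal with
  | |- measurable_fun _ (fun _ => (_ - _)%R) => apply: measurable_funB
  | |- measurable_fun _ (fun _ => (_ + _)%R) => apply: measurable_funD
  | |- measurable_fun _ (fun _ => (_ * _)%R) => apply: measurable_funM
  | |- measurable_fun _ (fun _ => (_, _)) => apply: measurable_fun_pair
  | |- measurable_fun _ (fun x => x.1.1) => apply: (@measurableT_comp _ _ _ _ _ _ fst)
  | |- measurable_fun _ (fun x => x.1.2) => apply: (@measurableT_comp _ _ _ _ _ _ snd)
  | |- measurable_fun _ fst => exact: measurable_fst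
  | |- measurable_fun _ snd => exact: measurable_snd
  | |- measurable_fun _ (fun x => x) => exact: measurable_id
  | |- measurable_fun _ (fun _ => _) =>
      first [exact: measurable_cst | exact: measurable_fst | exact: measurable_snd]
  end.

Section GaussianPlane.
Local Open Scope ereal_scope.
Context (R : realType).
Local Notation mu := (@lebesgue_measure R).
Local Notation N := (@normal_prob R 0 1).
Local Notation phi := (@normal_pdf R 0 1).

Lemma integral_normal_prob (f : R -> \bar R) :
  measurable_fun [set: R] f -> (forall x, 0 <= f x) ->
  \int[N]_x f x = \int[mu]_x (f x * (phi x)%:E).
Proof.
move=> mf f0.
have mphi : measurable_fun [set: measurableTypeR R] (phi : measurableTypeR R -> R).
  exact: measurable_normal_pdf.
have mid : measurable_fun [set: measurableTypeR R] (id : measurableTypeR R -> R).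
  exact: measurable_id.
have hind (A : set R) : measurable A ->
    \int[mu]_(x in id @^-1` A) (phi x)%:E = 1%:E * N A by rewrite mul1e.
have := @ge0_integral_weighted_comp _ _ _ _ R mu N id phi 1 ler01 mid mphi
  (normal_pdf_ge0 0 1) hind f mf f0.
by rewrite mul1e => <-.
Qed.

Lemma normal_pdf01E x : phi x = (normal_peak 1 * expR (- x ^+ 2 / 2))%R.
Proof. by rewrite normal_pdfE ?oner_neq0// /normal_fun subr0 expr1n. Qed.

Lemma normal_pdf_rotation (c q x y : R) : (c ^+ 2 + q ^+ 2 = 1)%R ->
  (phi (c * x - q * y) * phi (q * x + c * y) = phi x * phi y)%R.
Proof.
move=> cq; rewrite !normal_pdf01E mulrACA [RHS]mulrACA -!expRD; congr (_ * expR _)%R.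
transitivity (- ((c ^+ 2 + q ^+ 2) * (x ^+ 2 + y ^+ 2)) / 2)%R; first by field.
by rewrite cq; field.
Qed.

Lemma normal_integral2E (F : R * R -> \bar R) :
  measurable_fun [set: R * R] F -> (forall z, 0 <= F z) ->
  \int[N]_x \int[N]_y F (x, y) =
  \int[mu]_x \int[mu]_y (F (x, y) * (phi x * phi y)%:E).
Proof.
move=> mF F0.
have mFx x : measurable_fun [set: R] (fun y => F (x, y)) by exact: measurableT_comp.
have -> : \int[N]_x \int[N]_y F (x, y) = \int[mu]_x (\int[N]_y F (x, y) * (phi x)%:E).
  apply: integral_normal_prob.
    exact: (@measurable_fun_fubini_tonelli_F _ _ _ _ R N F mF F0).
  by move=> x; apply: integral_ge0.
apply: eq_integral => x _.
have -> : \int[N]_y F (x, y) = \int[mu]_y (F (x, y) * (phi y)%:E).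
  by apply: (integral_normal_prob (f := fun y => F (x, y))).
rewrite -ge0_integralZr//.
- by apply: eq_integral => y _; rewrite -muleA -EFinM [(phi y * _)%R]mulrC.
- apply: emeasurable_funM; first exact: mFx.
  by apply/measurable_EFinP; exact: measurable_normal_pdf.
- by move=> y _; rewrite mule_ge0// lee_fin normal_pdf_ge0.
- by rewrite lee_fin normal_pdf_ge0.
Qed.

Lemma normal_integral_swap (F : R * R -> \bar R) :
  measurable_fun [set: R * R] F -> (forall z, 0 <= F z) ->
  \int[N]_x \int[N]_y F (x, y) = \int[N]_y \int[N]_x F (x, y).
Proof. by move=> mF F0; exact: (@fubini_tonelli _ _ _ _ _ N N F mF F0). Qed.

(** The product density depends only on x ^+ 2 + y ^+ 2, so that this reduces
    to the Lebesgue case. *)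
Lemma normal_integral_rotation (c q : R) (F : R * R -> \bar R) :
  (0 <= c)%R -> (c ^+ 2 + q ^+ 2 = 1)%R ->
  measurable_fun [set: R * R] F -> (forall z, 0 <= F z) ->
  \int[N]_x \int[N]_y F (c * x - q * y, q * x + c * y)%R =
  \int[N]_x \int[N]_y F (x, y).
Proof.
move=> c0 cq mF F0; apply: etrans _ (esym (normal_integral2E mF F0)).
pose G (z : R * R) := F z * (phi z.1 * phi z.2)%:E.
have mG : measurable_fun [set: R * R] G.
  apply: emeasurable_funM => //; apply/measurable_EFinP.
  by apply: measurable_funM; apply: measurableT_comp => //; exact: measurable_normal_pdf.
have G0 z : 0 <= G z by rewrite mule_ge0// lee_fin mulr_ge0// normal_pdf_ge0.
apply: etrans _ (lebesgue_integral_rotation c0 cq mG G0).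
pose F' (z : R * R) := F (c * z.1 - q * z.2, q * z.1 + c * z.2)%R.
have mF' : measurable_fun [set: R * R] F'.
  by apply: measurable_fun_plane_map => //; measurable_affine.
apply: etrans (normal_integral2E mF' (fun=> F0 _)) _.
apply: eq_integral => x _; apply: eq_integral => y _.
by rewrite /G /F' /= normal_pdf_rotation.
Qed.

Lemma polar_nonneg (a b : R) : (0 <= a)%R -> exists r c q : R,
  [/\ 0 <= r, 0 <= c & c ^+ 2 + q ^+ 2 = 1]%R /\ a = (r * c)%R /\ b = (r * q)%R.
Proof.
move=> a0; have [ab0|ab0] := eqVneq (a ^+ 2 + b ^+ 2)%R 0%R.
  exists 0%R, 1%R, 0%R; split; first by split=> //; rewrite expr1n expr0n addr0.
  move/eqP: ab0; rewrite paddr_eq0 ?sqr_ge0// !sqrf_eq0 => /andP[/eqP -> /eqP ->].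
  by rewrite !mul0r.
have r2 : (Num.sqrt (a ^+ 2 + b ^+ 2) ^+ 2 = a ^+ 2 + b ^+ 2)%R.
  by rewrite sqr_sqrtr// addr_ge0// sqr_ge0.
have r0 : (Num.sqrt (a ^+ 2 + b ^+ 2) != 0)%R.
  by rewrite -sqrf_eq0 r2.
exists (Num.sqrt (a ^+ 2 + b ^+ 2)), (a / Num.sqrt (a ^+ 2 + b ^+ 2))%R,
  (b / Num.sqrt (a ^+ 2 + b ^+ 2))%R; split; last first.
  by split; rewrite mulrC divfK.
split; [exact: sqrtr_ge0|by rewrite divr_ge0// sqrtr_ge0|].
by rewrite !exprMn !exprVn r2 -mulrDl mulfV.
Qed.

End GaussianPlane.

(** * Joint law of two projections of a Gaussian vector *)

Section GramStep.
Local Open Scope ereal_scope.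
Context (R : realType).
Local Notation N := (@normal_prob R 0 1).

Lemma measurable_inner_normal (F : R * R -> \bar R) (f g : (R * R) * R -> R) :
  measurable_fun [set: R * R] F -> (forall z, 0 <= F z) ->
  measurable_fun [set: (R * R) * R] f -> measurable_fun [set: (R * R) * R] g ->
  measurable_fun [set: R * R] (fun z => \int[N]_r F (f (z, r), g (z, r))).
Proof.
move=> mF F0 mf mg.
pose H (u : (R * R) * R) := F (f u, g u).
have mH : measurable_fun [set: (R * R) * R] H.
  by apply: (measurableT_comp mF); exact: measurable_fun_pair.
exact: (@measurable_fun_fubini_tonelli_F _ _ _ _ R N H mH (fun=> F0 _)).
Qed.

(** With s, t, r independent standard normals, the pair
    (al s + a r, be s + ga t + b r) has the law of a pair of the same triangular
    form (al' s, be' s + ga' t): rotating (s, r) removes r from the first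
    component, and rotating (t, r) then removes it from the second one.  The
    three equations say that the Gram matrix is the expected one. *)
Lemma normal_gram_step (al be ga a b : R) : (0 <= al)%R -> (0 <= ga)%R ->
  exists al' be' ga' : R, [/\ 0 <= al', 0 <= ga', al' ^+ 2 = al ^+ 2 + a ^+ 2,
    al' * be' = al * be + a * b &
    be' ^+ 2 + ga' ^+ 2 = be ^+ 2 + ga ^+ 2 + b ^+ 2]%R /\
  forall F : R * R -> \bar R, measurable_fun [set: R * R] F -> (forall z, 0 <= F z) ->
    \int[N]_s \int[N]_t \int[N]_r F (al * s + a * r, be * s + ga * t + b * r)%R =
    \int[N]_s \int[N]_t F (al' * s, be' * s + ga' * t)%R.
Proof.
move=> al0 ga0.
have [r1 [c1 [q1 [[r10 c10 cq1] [alE aE]]]]] := polar_nonneg a al0.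
pose b1 := (be * c1 + b * q1)%R; pose b2 := (b * c1 - be * q1)%R.
have [r2 [c2 [q2 [[r20 c20 cq2] [gaE bE]]]]] := polar_nonneg b2 ga0.
exists r1, b1, r2; split.
  split=> //.
  - by rewrite alE aE !exprMn -mulrDr cq1 mulr1.
  - by rewrite /b1 alE aE; ring.
  - have -> : (r2 ^+ 2 = ga ^+ 2 + b2 ^+ 2)%R.
      by rewrite gaE bE !exprMn -mulrDr cq2 mulr1.
    rewrite /b1 /b2 -[X in (X + _)%R = _]mulr1.
    transitivity ((c1 ^+ 2 + q1 ^+ 2) * (be ^+ 2 + b ^+ 2) + ga ^+ 2)%R; first by ring.
    by rewrite cq1; ring.
move=> F mF F0.
pose H1 (z : R * R) := \int[N]_r F (al * z.1 + a * r, be * z.1 + ga * z.2 + b * r)%R.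
have mH1 : measurable_fun [set: R * R] H1.
  by apply: (@measurable_inner_normal F (fun u => al * u.1.1 + a * u.2)%R
    (fun u => be * u.1.1 + ga * u.1.2 + b * u.2)%R) => //; measurable_affine.
have H10 z : 0 <= H1 z by apply: integral_ge0.
pose H2 (z : R * R) := \int[N]_r F (r1 * z.1, b1 * z.1 + ga * z.2 + b2 * r)%R.
have mH2 : measurable_fun [set: R * R] H2.
  by apply: (@measurable_inner_normal F (fun u => r1 * u.1.1)%R
    (fun u => b1 * u.1.1 + ga * u.1.2 + b2 * u.2)%R) => //; measurable_affine.
have H20 z : 0 <= H2 z by apply: integral_ge0.
apply: etrans (normal_integral_swap mH1 H10) _.
transitivity (\int[N]_s \int[N]_t H2 (s, t)).
  apply: etrans _ (esym (normal_integral_swap mH2 H20)).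
  apply: eq_integral => t _.
  pose G (z : R * R) := F (r1 * z.1, b1 * z.1 + ga * t + b2 * z.2)%R.
  have mG : measurable_fun [set: R * R] G.
    by apply: measurable_fun_plane_map => //; measurable_affine.
  have cq1' : (c1 ^+ 2 + (- q1) ^+ 2 = 1)%R by rewrite sqrrN.
  apply: etrans _ (normal_integral_rotation c10 cq1' mG (fun=> F0 _)).
  apply: eq_integral => s _; apply: eq_integral => r _.
  rewrite /G /=; congr (F (_, _)); first by rewrite alE aE; ring.
  rewrite /b1 /b2.
  transitivity (be * s * (c1 ^+ 2 + q1 ^+ 2) + ga * t + b * r * (c1 ^+ 2 + q1 ^+ 2))%R.
    by rewrite cq1; ring.
  by ring.
apply: eq_integral => s _.
pose K (z : R * R) := F (r1 * s, b1 * s + r2 * z.1)%R.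
have mK : measurable_fun [set: R * R] K.
  by apply: measurable_fun_plane_map => //; measurable_affine.
have cq2' : (c2 ^+ 2 + (- q2) ^+ 2 = 1)%R by rewrite sqrrN.
transitivity (\int[N]_x \int[N]_y K (x, y)).
  apply: etrans _ (normal_integral_rotation c20 cq2' mK (fun=> F0 _)).
  apply: eq_integral => t _; apply: eq_integral => r _.
  by rewrite /K /=; congr (F (_, _)); rewrite gaE bE; ring.
apply: eq_integral => t _; rewrite /K /=.
by rewrite integral_cst// [X in _ * X](@probability_setT _ _ R N) mule1.
Qed.

End GramStep.

Section TriangularLaw.
Local Open Scope ereal_scope.
Context (R : realType).
Local Notation N := (@normal_prob R 0 1).

(** The law of (al s, be s + ga t) for independent standard normals s and
    t: the Cholesky form of a centered Gaussian law in the plane. *)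
Definition triangular_law (al be ga : R) (A : set (R * R)) : \bar R :=
  \int[N]_s \int[N]_t (\1_A (al * s, be * s + ga * t)%R)%:E.

Lemma integral_triangular_law (al be ga : R) (m : {measure set (R * R) -> \bar R}) :
  (forall A, measurable A -> m A = triangular_law al be ga A) ->
  forall F : R * R -> \bar R, measurable_fun [set: R * R] F -> (forall z, 0 <= F z) ->
  \int[m]_z F z = \int[N]_s \int[N]_t F (al * s, be * s + ga * t)%R.
Proof.
move=> mE F mF F0.
pose L (z : R * R) : R * R := (al * z.1, be * z.1 + ga * z.2)%R.
have mL : measurable_fun [set: R * R] L by rewrite /L; measurable_affine.
have mFL : measurable_fun [set: R * R] (F \o L) by exact: measurableT_comp.
apply: etrans _ (@fubini_tonelli1 _ _ _ _ R N N (F \o L) mFL (fun=> F0 _)).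
have F0' : {in [set: R * R], forall y, 0 <= F y} by [].
pose NN : {measure set (measurableTypeR R * measurableTypeR R)%type -> \bar R} := N \x N.
have mL' : measurable_fun [set: (measurableTypeR R * measurableTypeR R)%type]
    (L : (measurableTypeR R * measurableTypeR R)%type -> (R * R)%type) by exact: mL.
have := ge0_integral_pushforward mL' NN measurableT mF F0'.
rewrite preimage_setT => <-; apply: eq_measure_integral => A mA _.
rewrite mE// /pushforward /triangular_law.
pose g (z : R * R) : R := \1_A (L z).
have mg : measurable_fun [set: R * R] g.
  by apply: measurableT_comp mL; exact: measurable_indic.
have mA1 : measurable_fun [set: R * R] (fun z => (g z)%:E) by exact/measurable_EFinP.
have A10 z : 0 <= (g z)%:E by rewrite lee_fin /g.
apply: etrans (esym (@fubini_tonelli1 _ _ _ _ R N N _ mA1 A10)) _.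
have mLA : measurable (L @^-1` A) by rewrite -[X in measurable X]setTI; exact: mL.
have := integral_indic NN measurableT mLA; rewrite setIT => e.
exact: (etrans _ e).
Qed.
End TriangularLaw.

Section GaussianProjection.
Local Open Scope ereal_scope.
Context d (T : measurableType d) (R : realType) (P : probability T R) (p : nat).
Variables (x : T -> p.-tuple R) (a b : 'rV[R]_p).
Hypothesis mx : forall j : 'I_p, measurable_fun [set: T] (fun w => tnth (x w) j).
Hypothesis gauss_x : std_normal_vector P x.
Local Notation N := (@normal_prob R 0 1).

Let S (c : 'rV[R]_p) (k : nat) (w : T) : R :=
  (\sum_(j < p | (j < k)%N) tnth (x w) j * c 0%R j)%R.

Let mS c k : measurable_fun [set: T] (S c k).
Proof.
rewrite /S; under eq_fun => w do rewrite -big_filter.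
apply: measurable_sum => j; apply: measurable_funM => //; exact: measurable_cst.
Qed.

Let gram (k : nat) (u v : 'rV[R]_p) : R :=
  (\sum_(j < p | (j < k)%N) u 0%R j * v 0%R j)%R.

Let sumS (k : nat) (kp : (k < p)%N) (F : 'I_p -> R) :
  (\sum_(j < p | (j < k.+1)%N) F j = \sum_(j < p | (j < k)%N) F j + F (Ordinal kp))%R.
Proof.
rewrite (bigD1 (Ordinal kp)) /=; last exact: ltnSn.
rewrite addrC; congr (_ + _)%R; apply: eq_bigl => j.
rewrite ltnS leq_eqVlt; have [->|ne] := eqVneq j (Ordinal kp).
  by rewrite /= eqxx /= ltnn.
rewrite andbT; suff -> : (j == k :> nat) = false by [].
by apply: contraNF ne => /eqP e; apply/eqP/val_inj.
Qed.

Let tail (k : nat) (B : 'I_p -> set R) : set T :=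
  [set w | forall j : 'I_p, (k <= j)%N -> B j (tnth (x w) j)].

Let mtail k B : (forall j, measurable (B j)) -> measurable (tail k B).
Proof.
move=> mB.
have -> : tail k B = \bigcap_(j in [set j : 'I_p | (k <= j)%N])
    ((fun w => tnth (x w) j) @^-1` B j) by [].
apply: fin_bigcap_measurable => // j _.
by rewrite -[X in measurable X]setTI; exact: mx.
Qed.

(** The two sums over the first k coordinates have a triangular Gaussian law
    and are independent of the remaining coordinates; keeping the latter in the
    statement makes the induction on k go through. *)
Lemma gaussian_partial_sums (k : nat) : (k <= p)%N ->
  exists al be ga : R, [/\ 0 <= al, 0 <= ga, al ^+ 2 = gram k a a,
    al * be = gram k a b & be ^+ 2 + ga ^+ 2 = gram k b b]%R /\
  forall (A : set (R * R)) (B : 'I_p -> set R), measurable A ->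
    (forall j, measurable (B j)) ->
    P ([set w | A (S a k w, S b k w)] `&` tail k B) =
    triangular_law al be ga A * \prod_(j < p | (k <= j)%N) N (B j).
Proof.
elim: k => [_|k IH kp].
  exists 0%R, 0%R, 0%R; rewrite /gram !big1//; split.
    by split; rewrite ?expr0n ?mul0r ?addr0.
  move=> A B mA mB.
  have S0 c w : S c 0 w = 0%R by rewrite /S big1.
  have PB : P (tail 0 B) = \prod_(j < p | (0 <= j)%N) N (B j).
    have -> : tail 0 B = \bigcap_j ((fun w => tnth (x w) j) @^-1` B j).
      by apply/seteqP; split => w /= h j _; exact: h.
    rewrite gauss_x.1//; apply: eq_bigr => j _; exact: gauss_x.2.
  have tri : triangular_law 0 0 0 A = (\1_A (0, 0)%R : R)%:E.
    rewrite /triangular_law -[RHS](mule1) -[X in _ = _ * X](@probability_setT _ _ R N).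
    rewrite -integral_cst//; apply: eq_integral => s _.
    rewrite -[RHS](mule1) -[X in _ = _ * X](@probability_setT _ _ R N).
    rewrite -integral_cst//; apply: eq_integral => t _.
    by rewrite !mul0r addr0.
  rewrite tri indicE; have [/set_mem A0|/negP A0] := boolP (_ \in A).
    rewrite mul1e -PB; congr (P _); apply/seteqP; split => w /=; first by case.
    by rewrite !S0.
  rewrite mul0e (_ : _ `&` _ = set0) ?measure0//.
  apply/seteqP; split => w //= []; rewrite !S0 => h _; apply: A0.
  exact: mem_set.
have [al [be [ga [[al0 ga0 e1 e2 e3] law]]]] := IH (ltnW kp).
pose k' := Ordinal kp.
have [al' [be' [ga' [[al0' ga0' e1' e2' e3'] step]]]] :=
  normal_gram_step be (a 0%R k') (b 0%R k') al0 ga0.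
exists al', be', ga'; split.
  split=> //; rewrite /gram sumS.
  - by rewrite e1' e1 /gram expr2.
  - by rewrite e2' e2.
  - by rewrite e3' e3 /gram expr2.
move=> A B mA mB.
pose D := tail k.+1 B; have mD : measurable D by exact: mtail.
have N_ge0 (C : set R) : 0 <= N C by exact: measure_ge0.
pose c := \prod_(j < p | (k < j)%N) N (B j).
have c0 : 0 <= c by apply: prode_ge0.
have cfin : c \is a fin_num.
  by apply: prode_fin_num => j _; exact: (fin_num_measure N _ (mB j)).
have fc0 : (0 <= fine c)%R by exact: fine_ge0.
pose ST (w : T) := (S a k w, S b k w).
have mST : measurable_fun [set: T] ST by apply: measurable_fun_pair; exact: mS.
pose STm : {mfun T >-> (R * R)%type} := HB.pack ST (isMeasurableFun.Build _ _ _ _ _ mST).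
pose m1 : probability (R * R)%type R := distribution P STm.
pose xk (w : T) := tnth (x w) k'.
pose xkm : {mfun T >-> R} := HB.pack xk (isMeasurableFun.Build _ _ _ _ _ (mx k')).
pose nu : probability R R := distribution P xkm.
have nuE (C : set R) : measurable C -> nu C = N C by move=> mC; exact: gauss_x.2.
pose m2 : {finite_measure set R -> \bar R} := mscale (NngNum fc0) nu.
pose phi (w : T) := (ST w, xk w).
have mphi : measurable_fun [set: T] phi by apply: measurable_fun_pair => //; exact: mx.
have m1E C : measurable C -> m1 C = triangular_law al be ga C.
  move=> mC; have := law C (fun=> setT) mC (fun=> measurableT).
  rewrite big1 => [|j _]; last exact: (@probability_setT _ _ R N).
  rewrite mule1 => <-; congr (P _); apply/seteqP; split => w //=.
  by case.
have tailS (B1 : set R) : tail k (fun j => if j == k' then B1 else B j) =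
    xk @^-1` B1 `&` D.
  apply/seteqP; split => w /=.
    move=> h; split; first by have := h k'; rewrite eqxx; apply.
    move=> j kj; have := h j (ltnW kj); case: eqP => // jk.
    by move: kj; rewrite jk /= ltnn.
  move=> [h1 h2] j kj; case: eqP => [->//|jk]; apply: h2.
  by rewrite ltn_neqAle kj andbT; apply/eqP => e; apply: jk; apply/val_inj.
pose E : set ((R * R) * R) :=
  [set u | A (u.1.1 + a 0%R k' * u.2, u.1.2 + b 0%R k' * u.2)%R].
have mE : measurable E.
  have mf : measurable_fun [set: (R * R) * R]
      (fun u : (R * R) * R => (u.1.1 + a 0%R k' * u.2, u.1.2 + b 0%R k' * u.2)%R).
    by measurable_affine.
  by rewrite -[E]setTI; exact: mf.
have rect A1 B1 : measurable A1 -> measurable B1 ->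
    pushforward (mrestr P mD) phi (A1 `*` B1) = m1 A1 * m2 B1.
  move=> mA1 mB1; pose B' j := if j == k' then B1 else B j.
  have mB' j : measurable (B' j) by rewrite /B'; case: ifP.
  have := law A1 B' mA1 mB'; rewrite tailS -m1E// (bigD1 k')//= /B' eqxx.
  rewrite (eq_bigr (fun j => N (B j))); last by move=> j /andP[_ /negbTE ->].
  rewrite (eq_bigl (fun j : 'I_p => (k < j)%N)); last first.
    by move=> j; rewrite ltn_neqAle andbC eq_sym -val_eqE.
  rewrite -/c /m2 /= /mscale /= fineK// nuE// [c * _]muleC => <-.
  by rewrite /pushforward /mrestr; congr (P _); rewrite setIA.
(* On the event D, the law of (partial sums, coordinate k) is a product
   measure, because it is one on rectangles. *)
have key := product_measure_unique (m1 := m1) (m2 := m2)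
  (m' := measure_function_pushforward__canonical__measure_function_Measure
    (mrestr P mD) mphi) rect mE.
have -> : [set w | A (S a k.+1 w, S b k.+1 w)] `&` tail k.+1 B = phi @^-1` E `&` D.
  have SE u w : S u k.+1 w = (S u k w + u 0%R k' * xk w)%R.
    by rewrite /S (sumS kp) [(u _ _ * _)%R]mulrC.
  by apply/seteqP; split => w; rewrite /= !SE.
transitivity ((m1 \x m2) E); first by rewrite key.
pose one_A (z : R * R) : \bar R := (\1_A z)%:E.
have mone : measurable_fun [set: R * R] one_A.
  by apply/measurable_EFinP; exact: measurable_indic.
have one0 z : 0 <= one_A z by rewrite lee_fin.
pose G (z : R * R) := \int[N]_r one_A (z.1 + a 0%R k' * r, z.2 + b 0%R k' * r)%R.
have mG : measurable_fun [set: R * R] G.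
  by apply: (@measurable_inner_normal _ one_A (fun u => u.1.1 + a 0%R k' * u.2)%R
    (fun u => u.1.2 + b 0%R k' * u.2)%R) => //; measurable_affine.
have G0 z : 0 <= G z by apply: integral_ge0.
transitivity (\int[m1]_z (c * G z)).
  apply: eq_integral => z _; rewrite /= /m2 /mscale /= fineK//; congr (_ * _).
  have mEz : measurable (xsection E z) by exact: measurable_xsection.
  have e := integral_indic N measurableT mEz; rewrite setIT in e.
  apply: etrans (nuE _ mEz) _; apply: etrans (esym e) _.
  apply: eq_integral => r _; rewrite /one_A !indicE; congr (_%:R)%:E; congr nat_of_bool.
  by rewrite mem_xsection.
rewrite ge0_integralZl//; rewrite muleC; congr (_ * _).
rewrite (integral_triangular_law m1E mG G0).
exact: (step one_A mone one0).
Qed.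
End GaussianProjection.

(** * Estimates for the normal distribution *)

Section NormalEstimates.
Local Open Scope ereal_scope.
Context (R : realType).
Local Notation mu := (@lebesgue_measure R).
Local Notation N := (@normal_prob R 0 1).
Local Notation phi := (@normal_pdf R 0 1).

Lemma normal_prob_itv_ge (u v : R) : (- 2 <= u)%R -> (u <= v)%R -> (v <= 2)%R ->
  (phi 2 * (v - u))%:E <= N `[u, v]%classic.
Proof.
move=> u2 uv v2.
have -> : (phi 2 * (v - u))%:E = \int[mu]_(x in `[u, v]) (phi 2)%:E.
  rewrite integral_cst//= lebesgue_measure_itv/= lte_fin; case: ltP => [_|vu].
    by rewrite -EFinB -EFinM.
  by have -> : v = u; [apply/eqP; rewrite eq_le vu uv|rewrite subrr mulr0 mule0].
apply: ge0_le_integral => //.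
- by move=> x _; rewrite lee_fin normal_pdf_ge0.
- apply/measurable_EFinP; apply: measurable_funTS; exact: measurable_normal_pdf.
- move=> x /=; rewrite in_itv/= => /andP[ux xv]; rewrite lee_fin !normal_pdf01E.
  rewrite ler_wpM2l ?normal_peak_ge0// ler_expR !mulNr lerN2 ler_wpM2r//.
  have : (`|x| <= 2)%R by rewrite ler_norml (le_trans u2 ux) (le_trans xv v2).
  by move=> x2; rewrite -(real_normK (num_real x)) lerXn2r// nnegrE.
Qed.

(** Completing the square: expR (m x) times the standard normal density is
    expR (m ^+ 2 / 2) times the normal density centered at m. *)
Lemma normal_integral_expR (m : R) : \int[N]_x (expR (m * x))%:E = (expR (m ^+ 2 / 2))%:E.
Proof.
have mexp : measurable_fun [set: R] (fun x : R => (expR (m * x))%:E).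
  by apply/measurable_EFinP; apply: measurableT_comp => //; exact: measurable_funM.
rewrite (integral_normal_prob mexp); last by move=> x; rewrite lee_fin expR_ge0.
transitivity (\int[mu]_x ((expR (m ^+ 2 / 2))%:E * (normal_pdf m 1 x)%:E)).
  apply: eq_integral => x _; rewrite -!EFinM; congr EFin.
  rewrite normal_pdf01E normal_pdfE ?oner_neq0// /normal_fun expr1n.
  rewrite mulrCA [RHS]mulrCA -!expRD; congr (_ * expR _)%R.
  by rewrite -[(1 *+ 2)%R]/2%:R; field.
rewrite ge0_integralZl//.
- by rewrite integral_normal_pdf mule1.
- by apply/measurable_EFinP; exact: measurable_normal_pdf.
- by move=> x _; rewrite lee_fin normal_pdf_ge0.
Qed.

Lemma normal_integral_expR_norm : \int[N]_x (expR (2 * `|x|))%:E <= (2 * expR 2)%:E.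
Proof.
have mexp c : measurable_fun [set: measurableTypeR R] (fun x : R => (expR (c * x))%:E).
  by apply/measurable_EFinP; apply: measurableT_comp => //; exact: measurable_funM.
have -> : (2 * expR 2)%:E = \int[N]_x (expR (2 * x))%:E + \int[N]_x (expR (- 2 * x))%:E.
  rewrite !normal_integral_expR -EFinD; congr EFin; rewrite sqrrN.
  have -> : (2 ^+ 2 / 2 = 2 :> R)%R by rewrite expr2 mulfK.
  by rewrite mulrDl !mul1r.
rewrite -ge0_integralD//.
apply: ge0_le_integral => //.
- apply/measurable_EFinP; apply: measurableT_comp => //; exact: measurable_funM.
- by apply: emeasurable_funD; exact: mexp.
- move=> x _; rewrite -EFinD lee_fin; case: (lerP 0 x) => x0.
    by rewrite ger0_norm// lerDl expR_ge0.
  by rewrite ltr0_norm// mulrN -mulNr lerDr expR_ge0.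
Qed.

Lemma lebesgue_integral_opp (f : R -> \bar R) :
  measurable_fun [set: R] f -> (forall x, 0 <= f x) ->
  \int[mu]_x f (- x)%R = \int[mu]_x f x.
Proof.
move=> mf f0.
have ms : measurable_fun [set: measurableTypeR R] (fun x : R => (- x)%R : measurableTypeR R).
  exact: measurableT_comp.
have f0' : {in [set: R], forall y, 0 <= f y} by [].
have := ge0_integral_pushforward ms mu measurableT mf f0'.
rewrite preimage_setT => /esym; rewrite /= => ->.
by apply: eq_measure_integral => A mA _; exact: lebesgue_measureN.
Qed.

(** The density is at most normal_peak 1, and expR (- |x| / e) is e times the
    sum of the exponential density of rate e^-1 and of its reflection. *)
Lemma normal_integral_laplace (e : R) : (0 < e)%R ->
  \int[N]_x (expR (- (`|x| / e)))%:E <= (2 * normal_peak 1 * e)%:E.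
Proof.
move=> e0; have ei0 : (0 < e^-1)%R by rewrite invr_gt0.
pose E : R -> R := exponential_pdf e^-1.
have mE : measurable_fun [set: R] (fun x => (E x)%:E).
  by apply/measurable_EFinP; exact: measurable_exponential_pdf.
have E0 x : 0 <= (E x)%:E by rewrite lee_fin exponential_pdf_ge0// ltW.
have mE' : measurable_fun [set: R] (fun x => (E (- x))%:E).
  exact: (measurableT_comp mE).
have mL : measurable_fun [set: R] (fun x : R => (expR (- (`|x| / e)))%:E).
  apply/measurable_EFinP; apply: measurableT_comp => //; apply: measurableT_comp => //.
  by apply: measurable_funM => //; exact: measurable_normr.
rewrite (integral_normal_prob mL); last by move=> x; rewrite lee_fin expR_ge0.
have k0 : 0 <= (normal_peak 1 * e)%:E :> \bar R.
  by rewrite lee_fin mulr_ge0 ?normal_peak_ge0// ltW.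
have -> : (2 * normal_peak 1 * e)%:E =
    \int[mu]_x ((normal_peak 1 * e)%:E * ((E x)%:E + (E (- x))%:E)).
  rewrite ge0_integralZl//; last 2 first.
  - exact: emeasurable_funD.
  - by move=> x _; rewrite adde_ge0.
  rewrite ge0_integralD//.
  rewrite (lebesgue_integral_opp mE E0) (integral_exponential_pdf ei0).
  by rewrite -EFinD -EFinM; congr EFin; ring.
apply: ge0_le_integral => //.
- by move=> x _; rewrite mule_ge0// lee_fin ?expR_ge0 ?normal_pdf_ge0.
- by apply: emeasurable_funM => //; apply/measurable_EFinP; exact: measurable_normal_pdf.
- by apply: emeasurable_funM => //; exact: emeasurable_funD.
move=> x _; rewrite -EFinD -!EFinM lee_fin mulrC -mulrA.
apply: ler_pM; rewrite ?normal_pdf_ge0 ?expR_ge0 ?normal_pdf_ub ?oner_neq0//.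
have ee y : (0 <= y)%R -> (e * E y = expR (- (y / e)))%R.
  move=> y0; rewrite /E exponential_pdfE// mulrA divff ?gt_eqF// mul1r.
  by rewrite mulNr [(e^-1 * y)%R]mulrC.
have Er y : (0 <= E y)%R by rewrite -lee_fin.
rewrite mulrDr; case: (lerP 0 x) => x0.
  by rewrite ger0_norm// ee// lerDl mulr_ge0// ltW.
have nx0 : (0 <= - x)%R by rewrite oppr_ge0 ltW.
by rewrite ltr0_norm// (ee _ nx0) lerDr mulr_ge0// ltW.
Qed.

Lemma triangular_law_rect_ge (al be ga : R) (A : set (R * R)) (I J : set R) :
  measurable A -> measurable I -> measurable J ->
  (forall s t, I s -> J t -> A (al * s, be * s + ga * t)%R) ->
  N I * N J <= triangular_law al be ga A.
Proof.
move=> mA mI mJ IJA; rewrite /triangular_law.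
pose g (z : R * R) : R := \1_A (al * z.1, be * z.1 + ga * z.2)%R.
have mg : measurable_fun [set: R * R] (fun z => (g z)%:E).
  apply/measurable_EFinP; apply: (@measurableT_comp _ _ _ _ _ _ (\1_A : R * R -> R)).
    exact: measurable_indic.
  by measurable_affine.
have -> : N I * N J = \int[N]_s ((\1_I s)%:E * N J).
  rewrite ge0_integralZr//.
  - have mI' : measurable (I : set (measurableTypeR R)) by [].
    by rewrite (integral_indic N measurableT mI') setIT.
  - by apply/measurable_EFinP; exact: measurable_indic.
apply: ge0_le_integral => //.
- by move=> s _; rewrite mule_ge0// ?lee_fin.
- apply: emeasurable_funM; last exact: measurable_cst.
  by apply/measurable_EFinP; exact: measurable_indic.
- apply: (@measurable_fun_fubini_tonelli_F _ _ _ _ R N (fun z => (g z)%:E) mg).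
  by move=> z; rewrite lee_fin /g.
move=> s _; have mJ' : measurable (J : set (measurableTypeR R)) by [].
have e := integral_indic N measurableT mJ'; rewrite setIT in e.
apply: (@le_trans _ _ ((\1_I s)%:E * \int[N]_t (\1_J t)%:E)); first by rewrite e.
rewrite -ge0_integralZl//; last first.
  by apply/measurable_EFinP; exact: measurable_indic.
apply: ge0_le_integral => //.
- apply: emeasurable_funM; first exact: measurable_cst.
  by apply/measurable_EFinP; exact: measurable_indic.
- have mp : measurable_fun [set: R] (fun t : R => (s, t)).
    by apply: measurable_fun_pair => //; exact: measurable_cst.
  exact: (measurableT_comp mg mp).
move=> t _; rewrite -EFinM lee_fin.
rewrite !indicE; have [/set_mem Is|] := boolP (s \in I); last by rewrite mul0r.
have [/set_mem Jt|] := boolP (t \in J); last by rewrite mulr0.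
by rewrite mem_set//= ?mulr1//; exact: IJA.
Qed.

End NormalEstimates.

(** * Inner products and projections *)

Section Margins.
Context (R : realType) (p : nat).
Implicit Types (b u v : 'rV[R]_p).

(** The bound on the label, true almost surely, is part of the event in order
    to control how the margin changes with b. *)
Definition margin_event b (a : R) : set (p.-tuple R * R) :=
  [set s | `|s.2| <= 1 /\ s.2 * dot (vec s.1) b <= a].

Lemma measurable_dot_vec b : measurable_fun [set: p.-tuple R] (fun x => dot (vec x) b).
Proof.
rewrite /dot; apply: measurable_sum => j; apply: measurable_funM; last exact: measurable_cst.
by under eq_fun do rewrite mxE; exact: measurable_tnth.
Qed.

Lemma measurable_margin b :
  measurable_fun [set: (p.-tuple R * R)%type] (fun s => s.2 * dot (vec s.1) b).
Proof.
apply: measurable_funM => //; apply: (measurableT_comp (measurable_dot_vec b)).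
exact: measurable_fst.
Qed.

Lemma measurable_le_set d (T : measurableType d) (f : T -> R) (a : R) :
  measurable_fun [set: T] f -> measurable [set x | f x <= a].
Proof.
move=> mf; rewrite -[X in measurable X]setTI.
have -> : [set x | f x <= a] = f @^-1` `]-oo, a] by apply/seteqP; split => x /=; rewrite in_itv.
exact: mf.
Qed.

Lemma measurable_margin_event b a : measurable (margin_event b a).
Proof.
apply: measurableI; apply: measurable_le_set; last exact: measurable_margin.
by apply: measurableT_comp => //; exact: measurable_snd.
Qed.

Lemma sqr_l2norm u : l2norm u ^+ 2 = dot u u.
Proof.
rewrite /l2norm sqr_sqrtr; last by apply: sumr_ge0 => j _; exact: sqr_ge0.
by apply: eq_bigr => j _; rewrite expr2.
Qed.

Lemma l2norm_ge0 u : 0 <= l2norm u. Proof. exact: sqrtr_ge0. Qed.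

Lemma dotB u v : dot (u - v) (u - v) = dot u u - 2 * dot u v + dot v v.
Proof.
rewrite /dot mulr_sumr -sumrB -big_split/=.
by apply: eq_bigr => j _; rewrite !mxE; ring.
Qed.

Lemma dotC u v : dot u v = dot v u.
Proof. by apply: eq_bigr => j _; rewrite mulrC. Qed.

Lemma dotZr (k : R) u v : dot u (k *: v) = k * dot u v.
Proof. by rewrite /dot mulr_sumr; apply: eq_bigr => j _; rewrite [(k *: v) _ _]mxE mulrCA. Qed.
End Margins.

Section GaussianPairLaw.
Local Open Scope ereal_scope.
Context d (T : measurableType d) (R : realType) (P : probability T R) (p : nat).

Lemma gaussian_pair_law (x : T -> p.-tuple R) (u v : 'rV[R]_p) :
  measurable_fun [set: T] x -> std_normal_vector P x ->
  l2norm u = 1%R -> l2norm v = 1%R ->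
  exists ga : R, [/\ 0 <= ga & dot u v ^+ 2 + ga ^+ 2 = 1]%R /\
  forall A : set (R * R), measurable A ->
    P [set w | A (dot (vec (x w)) u, dot (vec (x w)) v)] =
    triangular_law 1 (dot u v) ga A.
Proof.
move=> mx gx u1 v1.
have mxj j : measurable_fun [set: T] (fun w => tnth (x w) j).
  exact: (measurableT_comp (measurable_tnth j)).
have [al [be [ga [[al0 ga0 e1 e2 e3] law]]]] :=
  gaussian_partial_sums u v mxj gx (leqnn p).
have full (F : 'I_p -> R) : (\sum_(j < p | (j < p)%N) F j = \sum_(j < p) F j)%R.
  by apply: eq_bigl => j; rewrite ltn_ord.
have dot1 (y : 'rV[R]_p) : l2norm y = 1%R -> (\sum_(j < p) y 0 j * y 0 j = 1)%R.
  by move=> y1; rewrite -[LHS]/(dot y y) -sqr_l2norm y1 expr1n.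
rewrite full dot1// in e1; rewrite full in e2; rewrite full dot1// in e3.
have al1 : al = 1%R.
  by apply/eqP; rewrite -(@eqrXn2 _ 2)// e1 expr1n.
move: e2 law; rewrite al1 mul1r => beE law; rewrite beE -[(\sum_(j < p) _)%R]/(dot u v) in law e3.
exists ga; split => // A mA.
have := law A (fun=> setT) mA (fun=> measurableT).
rewrite big1 => [|j _]; last exact: (@probability_setT _ _ R (normal_prob 0 1)).
rewrite mule1 => <-; congr (P _).
have dS (c : 'rV[R]_p) w : dot (vec (x w)) c =
    (\sum_(j < p | (j < p)%N) tnth (x w) j * c 0 j)%R.
  by rewrite full; apply: eq_bigr => j _; rewrite mxE.
apply/seteqP; split => w /=; first by rewrite !dS; split.
by rewrite !dS; case.
Qed.

Lemma gaussian_projection_law (x : T -> p.-tuple R) (u : 'rV[R]_p) (A : set R) :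
  measurable_fun [set: T] x -> std_normal_vector P x -> l2norm u = 1%R ->
  measurable A -> P [set w | A (dot (vec (x w)) u)] = normal_prob 0 1 A.
Proof.
move=> mx gx u1 mA; have [ga [_ law]] := gaussian_pair_law mx gx u1 u1.
have mA2 : measurable (A `*` [set: R]) by exact: measurableX.
have -> : [set w | A (dot (vec (x w)) u)] =
    [set w | (A `*` [set: R]) (dot (vec (x w)) u, dot (vec (x w)) u)].
  by apply/seteqP; split => w //= [].
rewrite (law _ mA2) /triangular_law.
transitivity (\int[normal_prob 0 1]_s (\1_A s : R)%:E); last first.
  have mA' : measurable (A : set (measurableTypeR R)) by [].
  by rewrite (integral_indic (normal_prob 0 1) measurableT mA') setIT.
apply: eq_integral => s _.
transitivity (\int[normal_prob 0 1]_(t in [set: R]) (\1_A s : R)%:E).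
  by apply: eq_integral => t _; rewrite !indicE in_setX in_setT andbT mul1r.
rewrite integral_cst// [X in _ * X](@probability_setT _ _ R (normal_prob 0 1)).
by rewrite mule1.
Qed.

(** The detour by a pushforward along the identity changes the carrier of the
    normal law to the sigma-algebra that R has as a measurable type. *)
Lemma integral_std_normal (X : T -> R) (f : R -> \bar R) :
  measurable_fun [set: T] X ->
  (forall A, measurable A -> P (X @^-1` A) = normal_prob 0 1 A) ->
  measurable_fun [set: R] f -> (forall s, 0 <= f s) ->
  \int[P]_w f (X w) = \int[normal_prob 0 1]_s f s.
Proof.
move=> mX law mf f0; have f0' : {in [set: R], forall y, 0 <= f y} by [].
have := ge0_integral_pushforward mX P measurableT mf f0'.
rewrite preimage_setT => <-.
have mid : measurable_fun [set: measurableTypeR R] (id : measurableTypeR R -> R).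
  exact: measurable_id.
have := ge0_integral_pushforward mid (normal_prob 0 1) measurableT mf f0'.
rewrite preimage_setT => <-; apply: eq_measure_integral => A mA _.
exact: law.
Qed.

Lemma integral_mul_independent d1 d2 (E1 : measurableType d1) (E2 : measurableType d2)
    (X : T -> E1) (Y : T -> E2) (F : E1 -> R) (G : E2 -> R) :
  measurable_fun [set: T] X -> measurable_fun [set: T] Y ->
  independent_pair P X Y ->
  measurable_fun [set: E1] F -> (forall s, 0 <= F s)%R ->
  measurable_fun [set: E2] G -> (forall s, 0 <= G s)%R ->
  \int[P]_w (G (Y w))%:E < +oo ->
  \int[P]_w (F (X w) * G (Y w))%:E =
  \int[P]_w (F (X w))%:E * \int[P]_w (G (Y w))%:E.
Proof.
move=> mX mY indep mF F0 mG G0 Gfin.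
have mXA A : measurable A -> measurable (X @^-1` A).
  by move=> mA; rewrite -[X in measurable X]setTI; exact: mX.
have mYA A : measurable A -> measurable (Y @^-1` A).
  by move=> mA; rewrite -[X in measurable X]setTI; exact: mY.
pose muX : {measure set E1 -> \bar R} :=
  measure_function_pushforward__canonical__measure_function_Measure P mX.
pose muY : {measure set E2 -> \bar R} :=
  measure_function_pushforward__canonical__measure_function_Measure P mY.
have intG : \int[P]_w (G (Y w))%:E = \int[muY]_s (G s)%:E.
  have G0' : {in [set: E2], forall y, 0 <= (G y)%:E} by move=> y _; rewrite lee_fin.
  by rewrite (ge0_integral_pushforward mY P measurableT _ G0')//; exact/measurable_EFinP.
have intF : \int[P]_w (F (X w))%:E = \int[muX]_s (F s)%:E.
  have F0' : {in [set: E1], forall y, 0 <= (F y)%:E} by move=> y _; rewrite lee_fin.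
  by rewrite (ge0_integral_pushforward mX P measurableT _ F0')//; exact/measurable_EFinP.
have intG0 : 0 <= \int[P]_w (G (Y w))%:E by apply: integral_ge0 => w _; rewrite lee_fin.
have fG : \int[P]_w (G (Y w))%:E \is a fin_num by rewrite ge0_fin_numE.
have mGY : measurable_fun [set: T] (G \o Y) by exact: measurableT_comp.
have half A : measurable A -> \int[P]_(w in X @^-1` A) (G (Y w))%:E =
    (fine (\int[P]_w (G (Y w))%:E))%:E * muX A.
  move=> mA; have PA : P (X @^-1` A) \is a fin_num by apply: fin_num_measure; exact: mXA.
  have m1 : measurable_fun [set: T] (\1_(X @^-1` A) : T -> R).
    by apply: measurable_indic; exact: mXA.
  have i0 w : (0 <= (\1_(X @^-1` A) w : R))%R by [].
  have hind (B : set E2) : measurable B ->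
      \int[P]_(w in Y @^-1` B) (\1_(X @^-1` A) w)%:E = (fine (P (X @^-1` A)))%:E * muY B.
    move=> mB; rewrite integral_indic; [|exact: mYA|exact: mXA].
    by rewrite fineK//; exact: indep.
  have mGe : measurable_fun [set: E2] (fun s => (G s)%:E) by exact/measurable_EFinP.
  have G0e s : 0 <= (G s)%:E by rewrite lee_fin.
  have e := ge0_integral_weighted_comp (fine_ge0 (measure_ge0 P _)) mY m1 i0 hind mGe G0e.
  rewrite -intG (fineK PA) in e; rewrite fineK// muleC; apply: etrans _ e.
  transitivity (\int[P]_w ((fun w => (G (Y w))%:E) \_ (X @^-1` A)) w).
    by rewrite integral_mkcond.
  apply: eq_integral => w _.
  by rewrite patchE indicE; case: ifPn => _; rewrite ?mule1 ?mule0.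
have mFe : measurable_fun [set: E1] (fun s => (F s)%:E) by exact/measurable_EFinP.
have F0e s : 0 <= (F s)%:E by rewrite lee_fin.
have e := ge0_integral_weighted_comp (fine_ge0 intG0) mX mGY (fun=> G0 _) half mFe F0e.
rewrite fineK// -intF in e; rewrite muleC; apply: etrans _ e.
by apply: eq_integral => w _; rewrite EFinM.
Qed.
End GaussianPairLaw.

(** * Margins in the sign model *)

Section SignModel.
Local Open Scope ereal_scope.
Context d (T : measurableType d) (R : realType) (P : probability T R) (p : nat).
Variables (sigma : R) (beta : 'rV[R]_p) (eps : {RV P >-> R})
  (z : {RV P >-> (p.-tuple R * R)%type}).
Hypothesis model : sign_model sigma beta eps z.
Hypothesis beta1 : l2norm beta = 1%R.
Local Notation N := (@normal_prob R 0 1).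
Local Notation kappa := (@normal_pdf R 0 1 2).
Let x (w : T) := (z w).1.

Let mx : measurable_fun [set: T] x.
Proof. exact: (measurableT_comp measurable_fst). Qed.

(** The label is the sign of the noisy projection almost surely only, which is
    why an inequality of probabilities replaces an inclusion of events. *)
Lemma sign_model_margin_ge (X : set T) (b : 'rV[R]_p) (a : R) : measurable X ->
  (forall w, X w -> (Num.sg (dot (vec (x w)) beta + sigma * eps w) *
     dot (vec (x w)) b <= a)%R) ->
  P X <= P (z @^-1` margin_event b a).
Proof.
move=> mX Xa; have [_ _ _ [Z [mZ PZ hZ]]] := model.
have mE : measurable (z @^-1` margin_event b a).
  by apply: measurable_funPTI; exact: measurable_margin_event.
have sub : X `<=` (z @^-1` margin_event b a) `|` Z.
  move=> w Xw; have [Zw|nZw] := pselect (Z w); [by right|left].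
  have zy : (z w).2 = Num.sg (dot (vec (x w)) beta + sigma * eps w).
    by apply: contrapT => ne; apply: nZw; exact: hZ.
  split; rewrite /= zy; last exact: Xa.
  by rewrite normr_sg; case: eqP.
apply: (le_trans (le_measure P _ _ sub)); rewrite ?inE//.
  exact: measurableU.
apply: (le_trans (measureU2 P mE mZ)).
by rewrite [X in _ + X]PZ adde0.
Qed.

Lemma sign_model_near_margin (b : 'rV[R]_p) (a : R) : l2norm b = 1%R ->
  (0 <= a <= 2)%R -> (kappa * a)%:E <= P (z @^-1` margin_event b a).
Proof.
move=> b1 /andP[a0 a2]; have [gx _ _ _] := model.
have mdb : measurable_fun [set: T] (fun w => dot (vec (x w)) b).
  exact: (measurableT_comp (measurable_dot_vec b)).
apply: le_trans (sign_model_margin_ge (X := [set w | `|dot (vec (x w)) b| <= a]%R) _ _).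
- have -> : [set w | `|dot (vec (x w)) b| <= a]%R =
      [set w | `[(- a)%R, a]%classic (dot (vec (x w)) b)].
    by apply/seteqP; split => w /=; rewrite in_itv/= ler_norml.
  rewrite (gaussian_projection_law mx gx b1)//.
  apply: le_trans (normal_prob_itv_ge _ _ a2); rewrite ?lerN2 ?ge0_cp//.
  by rewrite lee_fin ler_wpM2l ?normal_pdf_ge0// opprK lerDl.
- apply: measurable_le_set; exact: measurableT_comp.
move=> w /= wa; apply: le_trans wa; rewrite -[leRHS]mul1r.
apply: le_trans (ler_norm _) _; rewrite normrM ler_wpM2r// normr_sg.
by case: eqP.
Qed.

(** Write x . b = c u + ga g with u = x . beta and g standard normal.  If
    1 <= eps and 0 <= u then y = 1.  For c >= 0, b is misclassified as soon as
    u <= r and g <= - 1, because ga >= 2 r; this has probability of order r.  For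
    c < 0, it suffices that 1 <= u and g <= - 1, since ga - c >= 1. *)
Lemma sign_model_wrong_margin (b : 'rV[R]_p) (r : R) : (0 < sigma)%R ->
  l2norm b = 1%R -> (0 <= r <= 1)%R -> (4 * r <= l2norm (b - beta))%R ->
  (kappa ^+ 3 * r)%:E <= P (z @^-1` margin_event b (- r)).
Proof.
move=> s0 b1 /andP[r0 r1] br; have [gx gaussE indep _] := model.
have [ga [[ga0 cg] law]] := gaussian_pair_law mx gx beta1 b1.
set c := dot beta b in cg law.
have D2 : (l2norm (b - beta) ^+ 2 = 2 - 2 * c)%R.
  by rewrite sqr_l2norm dotB -!sqr_l2norm beta1 b1 expr1n dotC -/c; ring.
have rc : (16 * r ^+ 2 <= 2 - 2 * c)%R.
  rewrite -D2; have : ((4 * r) ^+ 2 <= l2norm (b - beta) ^+ 2)%R.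
    by rewrite lerXn2r// nnegrE ?mulr_ge0// l2norm_ge0.
  by apply: le_trans; rewrite exprMn; apply: ler_wpM2r; [exact: sqr_ge0|lra].
have k0 : (0 <= kappa)%R by exact: normal_pdf_ge0.
pose A : set (R * R) := [set u | (- u.1 <= 0)%R /\ (u.2 <= - r)%R].
have mA : measurable A.
  apply: measurableI; apply: measurable_le_set; last exact: measurable_snd.
  by apply: measurableT_comp => //; exact: measurable_fst.
pose B : set R := `[1%R, 2%R]%classic.
have mpair : measurable_fun [set: T] (fun w => (dot (vec (x w)) beta, dot (vec (x w)) b)).
  by apply: measurable_fun_pair; apply: (measurableT_comp (measurable_dot_vec _)).
pose X1 := (fun w => (dot (vec (x w)) beta, dot (vec (x w)) b)) @^-1` A.
have PX : P (X1 `&` eps @^-1` B) = triangular_law 1 c ga A * N B.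
  have := indep ((fun y => (dot (vec y) beta, dot (vec y) b)) @^-1` A) B.
  rewrite -law//; have eB : P (eps @^-1` B) = N B by apply: gaussE; exact: measurable_itv.
  rewrite -eB; apply; last exact: measurable_itv.
  rewrite -[X in measurable X]setTI.
  by apply: measurable_fun_pair => //; exact: measurable_dot_vec.
have NB : kappa%:E <= N B.
  by apply: le_trans (normal_prob_itv_ge _ _ _) => //; rewrite ?lee_fin; lra.
have NJ : kappa%:E <= N `[(- 2)%R, (- 1)%R]%classic.
  by apply: le_trans (normal_prob_itv_ge _ _ _) => //; rewrite ?lee_fin; lra.
have tri : (kappa ^+ 2 * r)%:E <= triangular_law 1 c ga A.
  have [c0|c0] := lerP 0%R c.
    have NI : (kappa * r)%:E <= N `[0%R, r]%classic.
      by apply: le_trans (normal_prob_itv_ge _ _ _) => //; rewrite ?subr0//; lra.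
    apply: le_trans (triangular_law_rect_ge (I := `[0%R, r]%classic)
      (J := `[(- 2)%R, (- 1)%R]%classic) mA _ _ _) => //.
      have NIJ : (kappa * r)%:E * kappa%:E <= N `[0%R, r]%classic * N `[(- 2)%R, (- 1)%R]%classic.
        by apply: lee_pmul => //; rewrite lee_fin ?mulr_ge0.
      by apply: le_trans NIJ; rewrite -EFinM lee_fin expr2 -!mulrA [(r * _)%R]mulrC.
    move=> s t /=; rewrite !in_itv/= => /andP[s0' sr] /andP[t2 t1].
    split=> /=; first by rewrite mul1r oppr_le0.
    (* ga ^+ 2 = (1 - c) (1 + c) is at least 1 - c, half the squared
       distance of b to beta. *)
    have ga2 : (2 * r <= ga)%R.
      rewrite -(@ler_pXn2r _ 2) ?nnegrE ?mulr_ge0//.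
      have -> : (ga ^+ 2 = 1 - c ^+ 2)%R by rewrite -cg; ring.
      by nra.
    by nra.
  have NI : kappa%:E <= N `[1%R, 2%R]%classic by [].
  apply: le_trans (triangular_law_rect_ge (I := `[1%R, 2%R]%classic)
    (J := `[(- 2)%R, (- 1)%R]%classic) mA _ _ _) => //.
    have NIJ : kappa%:E * kappa%:E <= N `[1%R, 2%R]%classic * N `[(- 2)%R, (- 1)%R]%classic.
      by apply: lee_pmul => //; rewrite lee_fin.
    by apply: le_trans NIJ; rewrite -EFinM lee_fin expr2 ler_piMr ?mulr_ge0.
  move=> s t /=; rewrite !in_itv/= => /andP[s1 s2] /andP[t2 t1]; split=> /=; first by lra.
  have : (1 <= ga - c)%R.
    rewrite -(@ler_pXn2r _ 2) ?nnegrE ?expr1n//; last by lra.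
    by nra.
  by nra.
apply: le_trans (sign_model_margin_ge (X := X1 `&` eps @^-1` B) _ _).
- have triB : (kappa ^+ 2 * r)%:E * kappa%:E <= triangular_law 1 c ga A * N B.
    by apply: lee_pmul => //; rewrite lee_fin ?mulr_ge0 ?sqr_ge0.
  by rewrite PX; apply: le_trans triB; rewrite -EFinM lee_fin exprSr mulrAC.
- apply: measurableI; first by rewrite -[X in measurable X]setTI; exact: mpair.
  by apply: measurable_funPTI; exact: measurable_itv.
move=> w [[/= u0 v0]]; rewrite /B /= in_itv/= => /andP[e1 e2].
rewrite gtr0_sg ?mul1r//; have := mulr_gt0 s0 (lt_le_trans ltr01 e1); lra.
Qed.

(** Almost surely - y u <= - |u| + 2 sigma |eps| for u = x . beta, so that
    the exponential splits into a function of x and a function of eps.  The first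
    one has mean of order delta, the second one is bounded in mean because
    sigma <= delta. *)
Lemma sign_model_reference_mgf (delta : R) : (0 < sigma)%R -> (sigma <= delta)%R ->
  \int[P]_w (1 + expR (- (z w).2 * dot (vec (x w)) (delta^-1 *: beta)))%:E <=
  (expR (4 * normal_peak 1 * expR 2 * delta))%:E.
Proof.
move=> s0 sd; have d0 : (0 < delta)%R by exact: lt_le_trans sd.
have [gx gaussE indep yE] := model.
pose F (y : p.-tuple R) := expR (- (`|dot (vec y) beta| / delta)).
pose G (e : R) := expR (2 * `|e|).
have mlap : measurable_fun [set: R] (fun s : R => expR (- (`|s| / delta))).
  apply: measurableT_comp => //; apply: measurableT_comp => //.
  by apply: measurable_funM => //; exact: measurable_normr.
have mF : measurable_fun [set: p.-tuple R] F.
  exact: (measurableT_comp mlap (measurable_dot_vec beta)).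
have mG : measurable_fun [set: R] G.
  by apply: measurableT_comp => //; exact: measurable_funM.
have F0 y : (0 <= F y)%R by exact: expR_ge0.
have G0 y : (0 <= G y)%R by exact: expR_ge0.
have meps : measurable_fun [set: T] eps by [].
have intG : \int[P]_w (G (eps w))%:E <= (2 * expR 2)%:E.
  rewrite (integral_std_normal (f := fun s => (G s)%:E) meps)//.
  - exact: normal_integral_expR_norm.
  - exact/measurable_EFinP.
have intF : \int[P]_w (F (x w))%:E <= (2 * normal_peak 1 * delta)%:E.
  rewrite (integral_std_normal (f := fun s => (expR (- (`|s| / delta)))%:E)
    (X := fun w => dot (vec (x w)) beta)).
  - exact: normal_integral_laplace.
  - exact: (measurableT_comp (measurable_dot_vec beta)).
  - by move=> A mA; exact: (gaussian_projection_law mx gx beta1).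
  - exact/measurable_EFinP.
  - by move=> s; rewrite lee_fin expR_ge0.
have intG0 : 0 <= \int[P]_w (G (eps w))%:E by apply: integral_ge0 => w _; rewrite lee_fin.
have intF0 : 0 <= \int[P]_w (F (x w))%:E by apply: integral_ge0 => w _; rewrite lee_fin.
have mFx : measurable_fun [set: T] (fun w => F (x w)) by exact: measurableT_comp.
have mGe : measurable_fun [set: T] (fun w => G (eps w)) by exact: measurableT_comp.
have mh : measurable_fun [set: T]
    (fun w => (1 + expR (- (z w).2 * dot (vec (x w)) (delta^-1 *: beta)))%R).
  apply: measurable_funD => //; apply: measurableT_comp => //; apply: measurable_funM.
    by apply: measurableT_comp => //; exact: (measurableT_comp measurable_snd).
  exact: (measurableT_comp (measurable_dot_vec _)).
apply: (@le_trans _ _ (\int[P]_w (1 + F (x w) * G (eps w))%:E)).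
  apply: ae_ge0_le_integral => //.
  - exact/measurable_EFinP.
  - by move=> w _; rewrite lee_fin addr_ge0// mulr_ge0.
  - apply/measurable_EFinP; apply: measurable_funD => //; exact: measurable_funM.
  have [Z [mZ PZ hZ]] := yE; exists Z; split => // w nh; apply: hZ => /= yw; apply: nh => _.
  rewrite lee_fin lerD2l /F /G -expRD ler_expR yw.
  have -> : dot (vec (x w)) (delta^-1 *: beta) = (delta^-1 * dot (vec (x w)) beta)%R.
    exact: dotZr.
  rewrite -/(x w); set u := dot (vec (x w)) beta; set e := eps w.
  have e2 : (sigma * `|e| / delta <= `|e|)%R.
    by rewrite ler_pdivrMr// mulrC ler_wpM2l.
  suff : (- Num.sg (u + sigma * e) * u <= - `|u| + 2 * (sigma * `|e|))%R.
    move=> h; rewrite mulrCA mulrC.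
    have := ler_wpM2r (ltW (_ : 0 < delta^-1)%R) h; rewrite invr_gt0 => /(_ d0).
    by move=> /le_trans; apply; lra.
  have se : (- (sigma * `|e|) <= sigma * e <= sigma * `|e|)%R.
    by rewrite -mulrN !ler_pM2l// -ler_norml lexx.
  move: se => /andP[se1 se2].
  case: (ltrgt0P (u + sigma * e)%R) => us; rewrite ?(gtr0_sg us) ?(ltr0_sg us) ?us ?sgr0.
  - by case: (lerP 0%R u) => u0; [rewrite ger0_norm//|rewrite ltr0_norm//]; lra.
  - by case: (lerP 0%R u) => u0; [rewrite ger0_norm//|rewrite ltr0_norm//]; lra.
  - by case: (lerP 0%R u) => u0; [rewrite ger0_norm//|rewrite ltr0_norm//]; lra.
under eq_integral do rewrite EFinD.
rewrite ge0_integralD//; last 2 first.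
- by move=> w _; rewrite lee_fin mulr_ge0.
- by apply/measurable_EFinP; exact: measurable_funM.
rewrite integral_cst// [X in 1 * X](@probability_setT _ _ R P) mule1.
rewrite (integral_mul_independent mx meps indep mF F0 mG G0); last first.
  by apply: le_lt_trans intG _; exact: ltry.
have FG := lee_pmul intF0 intG0 intF intG.
apply: le_trans (leeD2l _ FG) _.
rewrite -EFinM -EFinD lee_fin; apply: le_trans (expR_ge1Dx _); rewrite lerD2l.
by rewrite le_eqVlt; apply/orP; left; apply/eqP; ring.
Qed.

Lemma sign_model_coordinate_tail (s : R) (j : 'I_p) :
  P [set w | (s <= `|tnth (x w) j|)%R] <= (2 * expR 2 / expR (2 * s))%:E.
Proof.
have [[_ gx] _ _ _] := model.
have mxj : measurable_fun [set: T] (fun w => tnth (x w) j).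
  exact: (measurableT_comp (measurable_tnth j)).
have mG : measurable_fun [set: R] (fun e : R => expR (2 * `|e|)).
  by apply: measurableT_comp => //; exact: measurable_funM.
have -> : [set w | (s <= `|tnth (x w) j|)%R] =
    [set w | (expR (2 * s) <= expR (2 * `|tnth (x w) j|))%R].
  by apply/seteqP; split => w /=; rewrite ler_expR ler_pM2l.
apply: markov_ge0; rewrite ?expR_gt0//.
- exact: (measurableT_comp mG mxj).
- rewrite (integral_std_normal (f := fun s => (expR (2 * `|s|))%:E) mxj).
  + exact: normal_integral_expR_norm.
  + exact: gx.
  + exact/measurable_EFinP.
  + by move=> e; rewrite lee_fin expR_ge0.
Qed.
End SignModel.

(** * Union bound and nets *)

Section UnionBound.
Local Open Scope ereal_scope.
Context d (T : measurableType d) (R : realType) (P : probability T R).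

Lemma measurable_fin_exists (I : finType) (F : I -> set T) :
  (forall k, measurable (F k)) -> measurable [set w | exists k, F k w].
Proof.
move=> mF; have -> : [set w | exists k, F k w] = \bigcup_(k in [set: I]) F k.
  by apply/seteqP; split => [w [k Fk]|w [k _ Fk]]; exists k.
exact: fin_bigcup_measurable.
Qed.

Lemma union_bound (I : finType) (F : I -> set T) (e : R) :
  (forall k, measurable (F k)) -> (forall k, P (F k) <= e%:E) ->
  P [set w | exists k, F k w] <= (#|I|%:R * e)%:E.
Proof.
move=> mF Fe.
have seqb (s : seq I) : measurable [set w | exists2 k, k \in s & F k w] /\
    P [set w | exists2 k, k \in s & F k w] <= ((size s)%:R * e)%:E.
  elim: s => [|k s [ms IH]].
    rewrite mul0r (_ : [set w | _] = set0) ?measure0//.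
    by apply/seteqP; split => w // [].
  have -> : [set w | exists2 j, j \in k :: s & F j w] =
      F k `|` [set w | exists2 j, j \in s & F j w].
    apply/seteqP; split => [w [j]|w].
      by rewrite inE => /orP[/eqP ->|js] Fj; [left|right; exists j].
    by move=> [Fk|[j js Fj]]; [exists k; rewrite ?mem_head|exists j; rewrite ?inE ?js ?orbT].
  split; first exact: measurableU.
  apply: le_trans (measureU2 P (mF k) ms) _.
  by rewrite /= -natr1 mulrDl mul1r addrC EFinD leeD.
have [_] := seqb (enum I); rewrite -cardE; apply: le_trans.
rewrite le_eqVlt; apply/orP; left; apply/eqP; congr (P _).
by apply/seteqP; split => [w [k Fk]|w [k _ Fk]]; exists k; rewrite ?mem_enum.
Qed.
End UnionBound.

Section GridCover.
Context (R : realType) (p : nat).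

(** Any set of vectors in the cube, however irregular, has a finite net inside
    itself: pick one of its points in each grid cell that it meets.  Staying
    inside S matters, as probabilities are controlled for points of S only. *)
Lemma grid_cover (m : nat) (S : set 'rV[R]_p) (s0 : 'rV[R]_p) : (0 < m)%N -> S s0 ->
  (forall b, S b -> forall j, `|b 0 j| <= 1) ->
  exists rep : {ffun 'I_p -> 'I_(2 * m).+1} -> 'rV[R]_p,
    (forall k, S (rep k)) /\
    forall b, S b -> exists k, forall j, `|b 0 j - rep k 0 j| <= m%:R^-1.
Proof.
move=> m0 Ss0 Sb1.
pose cell (b : 'rV[R]_p) (j : 'I_p) : nat := Num.truncn ((b 0 j + 1) * m%:R).
pose C (k : {ffun 'I_p -> 'I_(2 * m).+1}) : set 'rV[R]_p :=
  [set b | S b /\ forall j, cell b j = k j].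
have mR : (0 : R) < m%:R by rewrite ltr0n.
have pos b j : S b -> 0 <= (b 0 j + 1) * m%:R.
  move=> Sb; rewrite mulr_ge0//; have := Sb1 b Sb j; rewrite ler_norml => /andP[]; lra.
exists (fun k => xget s0 (C k)); split.
  by move=> k; case: xgetP => [b _ []|].
move=> b Sb; pose k := [ffun j => inord (cell b j) : 'I_(2 * m).+1].
have kE j : k j = cell b j :> nat.
  rewrite ffunE inordK// ltnS -(ler_nat R) natrM.
  have /andP[h _] := truncn_itv (pos b j Sb); apply: le_trans h _.
  by rewrite ler_wpM2r//; have := Sb1 b Sb j; rewrite ler_norml => /andP[]; lra.
have Cb : C k b by split => // j; rewrite kE.
exists k => j; have [Sr Cr] := xgetPex s0 (ex_intro _ b Cb).
set r := xget s0 (C k) in Sr Cr *.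
have /andP[b1 b2] := truncn_itv (pos b j Sb).
have /andP[r1 r2] := truncn_itv (pos r j Sr).
have e : cell r j = cell b j by rewrite Cr kE.
move: r1 r2; rewrite -/(cell r j) e /cell => r1 r2.
rewrite -[leRHS]mul1r ler_pdivlMr// -[X in _ * X](gtr0_norm mR) -normrM ler_norml.
move: b1 b2 r1 r2; rewrite -natr1; nra.
Qed.
End GridCover.

(** * Uniform lower bounds on margin counts *)

Section UniformCount.
Context (R : realType) (p n : nat).
Context d0 d (T0 : measurableType d0) (T : measurableType d)
  (P0 : probability T0 R) (P : probability T R).
Variables (z : {RV P0 >-> (p.-tuple R * R)%type})
  (Z : 'I_n -> {RV P >-> (p.-tuple R * R)%type}).
Hypothesis iid : iid_copies z Z.

Let count (b : 'rV[R]_p) (a : R) (w : T) : R :=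
  \sum_(i < n) \1_(margin_event b a) (Z i w).

(** Chernoff bound with exponent - 1: expR (- 1) is at most 1 / 2, so that the
    mean of expR (- 1_A) is at most 1 - q / 2. *)
Lemma count_lower_tail (b : 'rV[R]_p) (a q : R) :
  (q%:E <= P0 (z @^-1` margin_event b a))%E ->
  (P [set w | (count b a w <= n%:R * q / 4)%R] <= (expR (- (n%:R * q / 4)))%:E)%E.
Proof.
move=> Pq; pose h (s : p.-tuple R * R) : R := expR (- \1_(margin_event b a) s).
have mE := measurable_margin_event b a.
have mEz : measurable (z @^-1` margin_event b a) by exact: measurable_funPTI.
have mh : measurable_fun [set: (p.-tuple R * R)%type] h.
  by apply: measurableT_comp => //; apply: measurableT_comp => //; exact: measurable_indic.
have h0 s : 0 <= h s by exact: expR_ge0.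
have mhz : measurable_fun [set: T0] (fun w => h (z w)) by exact: measurableT_comp.
have mgf : (\int[P0]_w (h (z w))%:E <= (expR (- (q / 2)))%:E)%E.
  have half : expR (- 1) <= 2^-1 :> R.
    rewrite expRN lef_pV2 ?posrE ?expR_gt0//.
    by have := expR_ge1Dx (1 : R); apply: le_trans; lra.
  have le1 : (\int[P0]_w (h (z w))%:E + 2^-1%:E * P0 (z @^-1` margin_event b a) <= 1)%E.
    have -> : (2^-1%:E * P0 (z @^-1` margin_event b a) =
        \int[P0]_w (2^-1 * \1_(z @^-1` margin_event b a) w)%:E)%E.
      under eq_integral do rewrite EFinM.
      rewrite ge0_integralZl//; last first.
        by apply/measurable_EFinP; exact: measurable_indic.
      by rewrite integral_indic// setIT.
    rewrite -ge0_integralD//; last 3 first.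
    - by move=> w _; rewrite lee_fin.
    - exact/measurable_EFinP.
    - by apply/measurable_EFinP; apply: measurable_funM => //; exact: measurable_indic.
    rewrite -[leRHS](@probability_setT _ _ R P0) -[leRHS]mul1e -integral_cst//.
    apply: ge0_le_integral => //.
    - by move=> w _; rewrite lee_fin addr_ge0// mulr_ge0.
    - apply: emeasurable_funD; apply/measurable_EFinP => //.
      by apply: measurable_funM => //; exact: measurable_indic.
    - move=> w _; rewrite -EFinD lee_fin /h.
      have -> : \1_(z @^-1` margin_event b a) w = \1_(margin_event b a) (z w) :> R by [].
      rewrite indicE; case: (_ \in _) => /=; last by rewrite oppr0 expR0 mulr0 addr0.
      lra.
  have : (\int[P0]_w (h (z w))%:E + (q / 2)%:E <= 1)%E.
    apply: le_trans le1; rewrite leeD2l// mulrC EFinM lee_pmul2l// ?lte_fin ?invr_gt0//.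
  rewrite -leeBrDr// => /le_trans; apply.
  by rewrite -EFinB lee_fin; exact: expR_ge1Dx.
have := iid_chernoff (- (n%:R * q / 4)) iid mh h0 mgf.
have -> : [set w | expR (- (n%:R * q / 4)) <= \prod_(i < n) h (Z i w)] =
    [set w | count b a w <= n%:R * q / 4].
  apply/seteqP; split => w /=; rewrite /h -expR_sum ler_expR sumrN lerN2//.
by rewrite (_ : n%:R * (- (q / 2)) - - (n%:R * q / 4) = - (n%:R * q / 4))//; field.
Qed.


(** The mesh n ^- 4 makes the net error at most n ^- 2 when the entries of
    the design are at most n. *)
Lemma grid_size_le : (1 < n)%N ->
  #|{ffun 'I_p -> 'I_(2 * n ^ 4).+1}|%:R <= expR (6 * (p%:R * ln n%:R)) :> R.
Proof.
move=> n1; rewrite card_ffun !card_ord natrX.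
have n0 : (0 : R) < n%:R by rewrite ltr0n ltnW.
have -> : 6 * (p%:R * ln n%:R) = p%:R * ln (n%:R ^+ 6 : R) by rewrite lnXn// -mulr_natl; ring.
rewrite expRM_natl lnK ?posrE ?exprn_gt0//.
rewrite lerXn2r ?nnegrE ?exprn_ge0// -natrX ler_nat.
have n2 : (4 <= n ^ 2)%N by rewrite (leq_sqr 2 n).
have n4 : (0 < n ^ 4)%N by rewrite expn_gt0 ltnW.
rewrite (_ : (n ^ 6 = n ^ 2 * n ^ 4)%N); last by rewrite -expnD.
by apply: leq_trans (leq_mul n2 (leqnn _)); lia.
Qed.

Lemma dot_perturbation (x : p.-tuple R) (b b' : 'rV[R]_p) (c e : R) : 0 <= e ->
  (forall j, `|tnth x j| <= c) -> (forall j, `|b 0 j - b' 0 j| <= e) ->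
  `|dot (vec x) b - dot (vec x) b'| <= p%:R * (c * e).
Proof.
move=> e0 xc be; rewrite /dot -sumrB.
apply: le_trans (ler_norm_sum _ _ _) _.
rewrite -[p in p%:R]card_ord -sum1_card natr_sum mulr_suml.
apply: ler_sum => j _; rewrite mul1r -mulrBr normrM mxE ler_pM//.
Qed.

(** Union bound over a net of S, then replacement of a point of S by its
    neighbour in the net at the price of n ^- 2 in the margin.  The hypothesis on
    q says that the deviation exponent n q / 4 exceeds the log-cardinality of the
    net by t. *)
Lemma uniform_margin_count (S : set 'rV[R]_p) (a q t : R) : (0 < p < n)%N ->
  (forall b, S b -> forall j, `|b 0 j| <= 1) ->
  (forall b, S b -> (q%:E <= P0 (z @^-1` margin_event b a))%E) ->
  4 * (6 * (p%:R * ln n%:R) + t) <= n%:R * q ->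
  exists G : set T, [/\ measurable G, (P (~` G) <= (expR (- t))%:E)%E &
    forall w, G w -> (forall i j, `|tnth (Z i w).1 j| <= n%:R) ->
    forall b, S b -> n%:R * q / 4 <=
      \sum_(i < n) (nat_of_bool ((Z i w).2 * dot (vec (Z i w).1) b <= a + (n%:R ^+ 2)^-1)%R)%:R].
Proof.
move=> /andP[p0 pn] Sb1 Sq qt.
have [[s0 Ss0]|Sempty] := pselect (exists b, S b); last first.
  exists setT; split; first exact: measurableT.
    by rewrite setCT measure0 lee_fin expR_ge0.
  by move=> w _ _ b Sb; exfalso; apply: Sempty; exists b.
have n1 : (1 < n)%N by exact: leq_ltn_trans p0 pn.
have n0 : (0 : R) < n%:R by rewrite ltr0n ltnW.
have m0 : (0 < n ^ 4)%N by rewrite expn_gt0 ltnW.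
have [rep [Srep near]] := grid_cover m0 Ss0 Sb1.
pose F k := [set w | count (rep k) a w <= n%:R * q / 4].
have mcount b : measurable_fun [set: T] (count b a).
  apply: measurable_sum => i; apply: measurableT_comp => //.
  by apply: measurable_indic; exact: measurable_margin_event.
have mF k : measurable (F k) by exact: measurable_le_set.
have PF k : (P (F k) <= (expR (- (n%:R * q / 4)))%:E)%E.
  by apply: count_lower_tail; exact: Sq.
exists (~` [set w | exists k, F k w]); split.
- by apply: measurableC; exact: measurable_fin_exists.
- rewrite setCK; apply: le_trans (union_bound mF PF) _; rewrite lee_fin.
  apply: le_trans (ler_wpM2r (expR_ge0 _) (grid_size_le n1)) _.
  by rewrite -expRD ler_expR; lra.
move=> w Gw xn b Sb; have [k bk] := near b Sb.
have /ltW cnt : n%:R * q / 4 < count (rep k) a w.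
  by rewrite ltNge; apply/negP => Fk; apply: Gw; exists k.
apply: le_trans cnt _; apply: ler_sum => i _.
rewrite indicE; case: (boolP (Z i w \in _)) => // /set_mem [y1 yx].
suff -> : (Z i w).2 * dot (vec (Z i w).1) b <= a + (n%:R ^+ 2)^-1 by [].
have pert : `|dot (vec (Z i w).1) b - dot (vec (Z i w).1) (rep k)| <= (n%:R ^+ 2)^-1.
  have mi0 : 0 <= (n ^ 4)%:R^-1 :> R by rewrite invr_ge0.
  apply: le_trans (dot_perturbation mi0 (xn i) bk) _.
  have pnR : p%:R <= n%:R :> R by rewrite ler_nat ltnW.
  apply: (@le_trans _ _ (n%:R * (n%:R * (n ^ 4)%:R^-1))).
    by rewrite ler_wpM2r// mulr_ge0.
  rewrite le_eqVlt; apply/orP; left; apply/eqP; rewrite natrX.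
  by field; rewrite gt_eqF.
rewrite -lerBlDl; apply: le_trans pert.
apply: (@le_trans _ _ ((Z i w).2 * dot (vec (Z i w).1) b -
    (Z i w).2 * dot (vec (Z i w).1) (rep k))); first by rewrite lerD2l lerN2.
rewrite -mulrBr; apply: le_trans (ler_norm _) _.
by rewrite normrM ler_piMl.
Qed.

End UniformCount.

(** * Low loss localizes the estimator *)

Section LogisticLoss.
Context (R : realType) (n p : nat).
Implicit Types (b beta gamma : 'rV[R]_p) (s : 'I_n -> p.-tuple R * R).

Lemma l2normZ (k : R) b : l2norm (k *: b) = `|k| * l2norm b.
Proof.
rewrite /l2norm -sqrtr_sqr -sqrtrM ?sqr_ge0// mulr_sumr; congr Num.sqrt.
by apply: eq_bigr => j _; rewrite mxE exprMn.
Qed.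

Lemma unit_coordinate_le1 b : l2norm b = 1 -> forall j, `|b 0 j| <= 1.
Proof.
move=> b1 j; have : b 0 j ^+ 2 <= 1.
  rewrite -(expr1n R 2) -b1 sqr_l2norm /dot (bigD1 j)//= -expr2 lerDl.
  by apply: sumr_ge0 => i _; rewrite -expr2 sqr_ge0.
by rewrite -[leRHS](expr1n R 2) -(real_normK (num_real _)) ler_pXn2r// nnegrE.
Qed.

(** The zero vector gets an arbitrary direction, here beta. *)
Lemma polar_decomposition beta gamma : l2norm beta = 1 ->
  exists b, [/\ l2norm b = 1, gamma = l2norm gamma *: b &
    l2norm gamma != 0 -> b = (l2norm gamma)^-1 *: gamma].
Proof.
move=> beta1; have [g0|g0] := eqVneq (l2norm gamma) 0.
  exists beta; split=> //; rewrite g0 scale0r.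
  have := sqr_l2norm gamma; rewrite g0 expr0n /= => /esym/eqP.
  rewrite psumr_eq0 => [/allP gj|j _]; last by rewrite -expr2 sqr_ge0.
  apply/rowP => j; rewrite mxE; apply/eqP.
  by have := gj j (mem_index_enum j); rewrite /= mulf_eq0 orbb.
exists ((l2norm gamma)^-1 *: gamma); split=> //.
  by rewrite l2normZ ger0_norm ?invr_ge0 ?l2norm_ge0// mulVf.
by rewrite scalerA divff// scale1r.
Qed.

Lemma ler_ln1DexpR (r r' : R) : r <= r' -> ln (1 + expR r) <= ln (1 + expR r').
Proof.
by move=> rr; rewrite ler_ln ?posrE ?addr_gt0 ?expR_gt0// lerD2l ler_expR.
Qed.

Lemma ln1DexpR_ge (r : R) : r <= ln (1 + expR r).
Proof.
by rewrite -[leLHS]expRK ler_ln ?posrE ?addr_gt0 ?expR_gt0// lerDr.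
Qed.

Lemma logistic_loss_ge s gamma (A : 'I_n -> bool) (l : R) :
  (forall i, A i -> l <= ln (1 + expR (- (s i).2 * dot (vec (s i).1) gamma))) ->
  (\sum_(i < n) (nat_of_bool (A i))%:R) * l <= logistic_loss s gamma.
Proof.
move=> Al; rewrite mulr_suml; apply: ler_sum => i _.
case: (boolP (A i)) => [/Al|_]; first by rewrite mul1r.
by rewrite mul0r ln_ge0// lerDl expR_ge0.
Qed.

(** A vector of norm less than rho gives a loss of at least
    ln (1 + expR (- 1)) to each of the k0 samples of small margin; a vector of
    norm at least rho in a direction far from beta gives at least rho * h to each
    of its k0 samples of margin below - h.  Both totals exceed L0. *)
Lemma low_loss_localizes s beta gamma (rho h D k0 L0 : R) : l2norm beta = 1 ->
  0 < rho -> 0 <= h ->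
  L0 < k0 * ln (1 + expR (- 1)) -> L0 < k0 * (rho * h) ->
  (forall b, l2norm b = 1 -> k0 <= \sum_(i < n)
     (nat_of_bool ((s i).2 * dot (vec (s i).1) b <= rho^-1)%R)%:R) ->
  (forall b, l2norm b = 1 -> D <= l2norm (b - beta) -> k0 <= \sum_(i < n)
     (nat_of_bool ((s i).2 * dot (vec (s i).1) b <= - h)%R)%:R) ->
  logistic_loss s gamma <= L0 ->
  l2norm ((l2norm gamma)^-1 *: gamma - beta) <= D /\ rho <= l2norm gamma.
Proof.
move=> beta1 rho0 h0 Ll Lh near far loss.
have [b [b1 gE bE]] := polar_decomposition gamma beta1.
set tau := l2norm gamma in gE bE *.
have tau0 : 0 <= tau by exact: l2norm_ge0.
have l0 : 0 <= ln (1 + expR (- 1)) :> R by rewrite ln_ge0// lerDl expR_ge0.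
have margin i : - (s i).2 * dot (vec (s i).1) gamma =
    - (tau * ((s i).2 * dot (vec (s i).1) b)).
  by rewrite gE dotZr; ring.
have rt : rho <= tau.
  rewrite leNgt; apply/negP => tr.
  have := @logistic_loss_ge s gamma
    (fun i => (s i).2 * dot (vec (s i).1) b <= rho^-1) (ln (1 + expR (- 1))).
  have /[swap]/[apply] : forall i, (s i).2 * dot (vec (s i).1) b <= rho^-1 ->
      ln (1 + expR (- 1)) <= ln (1 + expR (- (s i).2 * dot (vec (s i).1) gamma)).
    move=> i mi; apply: ler_ln1DexpR; rewrite margin lerN2.
    apply: le_trans (ler_wpM2l tau0 mi) _.
    by rewrite ler_pdivrMr// mul1r ltW.
  move/(le_trans (ler_wpM2r l0 (near b b1))) => /le_trans/(_ loss).
  by rewrite leNgt Ll.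
split=> //.
have tau_gt0 : 0 < tau by exact: lt_le_trans rt.
rewrite -bE ?gt_eqF// leNgt; apply/negP => Db.
have rh0 : 0 <= rho * h by rewrite mulr_ge0// ltW.
have := @logistic_loss_ge s gamma
  (fun i => (s i).2 * dot (vec (s i).1) b <= - h) (rho * h).
have /[swap]/[apply] : forall i, (s i).2 * dot (vec (s i).1) b <= - h ->
    rho * h <= ln (1 + expR (- (s i).2 * dot (vec (s i).1) gamma)).
  move=> i mi; apply: le_trans (ln1DexpR_ge _); rewrite margin.
  rewrite -mulrN; apply: (@le_trans _ _ (tau * h)); first by rewrite ler_wpM2r.
  by rewrite ler_wpM2l// lerNr.
move/(le_trans (ler_wpM2r rh0 (far b b1 (ltW Db)))) => /le_trans/(_ loss).
by rewrite leNgt Lh.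
Qed.

End LogisticLoss.

(** * Good events and conclusion *)

Section GoodEvents.
Context (R : realType) (p n : nat).
Context d0 d (T0 : measurableType d0) (T : measurableType d)
  (P0 : probability T0 R) (P : probability T R).
Variables (sigma : R) (beta : 'rV[R]_p) (eps : {RV P0 >-> R})
  (z : {RV P0 >-> (p.-tuple R * R)%type})
  (Z : 'I_n -> {RV P >-> (p.-tuple R * R)%type}).
Hypothesis model : sign_model sigma beta eps z.
Hypothesis iid : iid_copies z Z.

(** Union bound over the n p entries; expR (- 2 n) is far below expR (- t) since
    t, as well as ln n, is at most n / 10. *)
Lemma bounded_design_event (t : R) : (0 < p < n)%N ->
  p%:R * ln n%:R + t <= n%:R / 10 -> 0 < t ->
  exists G : set T, [/\ measurable G, (P (~` G) <= (expR (- t))%:E)%E &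
    forall w, G w -> forall i j, `|tnth (Z i w).1 j| <= n%:R].
Proof.
move=> /andP[p0 pn] tn t0.
pose F (k : 'I_n * 'I_p) := [set w | n%:R <= `|tnth (Z k.1 w).1 k.2| ].
have mtn j : measurable_fun [set: (p.-tuple R * R)%type] (fun s => `|tnth s.1 j|).
  apply: measurableT_comp => //.
  exact: (measurableT_comp (measurable_tnth j) measurable_fst).
have mge j : measurable [set s : p.-tuple R * R | n%:R <= `|tnth s.1 j| ].
  have -> : [set s : p.-tuple R * R | n%:R <= `|tnth s.1 j| ] =
    [set s | - `|tnth s.1 j| <= - n%:R] by apply/seteqP; split => s /=; rewrite lerN2.
  by apply: measurable_le_set; apply: measurableT_comp.
have mF k : measurable (F k).
  have -> : F k = Z k.1 @^-1` [set s | n%:R <= `|tnth s.1 k.2| ] by [].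
  by apply: measurable_funPTI; exact: mge.
have PF k : (P (F k) <= (2 * expR 2 / expR (2 * n%:R))%:E)%E.
  have -> : P (F k) = P0 [set w | n%:R <= `|tnth (z w).1 k.2| ].
    exact: (iid.2 k.1 _ (mge k.2)).
  exact: (sign_model_coordinate_tail model).
exists (~` [set w | exists k, F k w]); split.
- by apply: measurableC; exact: measurable_fin_exists.
- rewrite setCK; apply: le_trans (union_bound mF PF) _; rewrite lee_fin.
  rewrite card_prod !card_ord natrM.
  have n1 : (1 < n)%N by exact: leq_ltn_trans p0 pn.
  have n0 : (0 : R) < n%:R by rewrite ltr0n ltnW.
  have lnn : ln n%:R <= n%:R / 10 :> R.
    apply: le_trans tn; rewrite -[leLHS]mul1r ler_wpDr ?(ltW t0)//.
    by rewrite ler_wpM2r ?ln_ge0 ?ler1n// ltnW.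
  have nE : expR (ln n%:R) = n%:R :> R by rewrite lnK// posrE.
  have pnR : p%:R <= n%:R :> R by rewrite ler_nat ltnW.
  have e2 : 2 <= expR 1 :> R by have := expR_ge1Dx (1 : R); apply: le_trans; lra.
  have n2 : 2 <= n%:R :> R by rewrite ler_nat.
  have tn' : t <= n%:R / 10.
    apply: le_trans tn; rewrite lerDr mulr_ge0// ln_ge0// ler1n ltnW//.
  apply: (@le_trans _ _ (expR (ln n%:R + ln n%:R + (1 + 2 - 2 * n%:R)))).
    rewrite !expRD expRN nE -!mulrA ler_wpM2l//.
    have X0 : 0 <= expR 2 * (expR (2 * n%:R))^-1 :> R.
      by rewrite mulr_ge0 ?invr_ge0 ?expR_ge0.
    by apply: ler_pM => //; rewrite ler_wpM2r.
  rewrite ler_expR; lra.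
move=> w Gw i j; rewrite leNgt; apply/negP => lt; apply: Gw.
by exists (i, j); rewrite /F /= ltW.
Qed.

Lemma reference_loss_event (delta t : R) : l2norm beta = 1 ->
  0 < sigma -> sigma <= delta -> t <= n%:R * delta ->
  exists G : set T, [/\ measurable G, (P (~` G) <= (expR (- t))%:E)%E &
    forall w, G w -> logistic_loss (fun i => Z i w) (delta^-1 *: beta) <=
      (4 * normal_peak 1 * expR 2 + 1) * (n%:R * delta)].
Proof.
move=> beta1 s0 sd tn; set K := 4 * _ * _.
pose h (s : p.-tuple R * R) : R := 1 + expR (- s.2 * dot (vec s.1) (delta^-1 *: beta)).
have h_gt0 s : 0 < h s by rewrite addr_gt0// expR_gt0.
have mh : measurable_fun [set: (p.-tuple R * R)%type] h.
  apply: measurable_funD => //; apply: measurableT_comp => //; apply: measurable_funM.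
    by apply: measurableT_comp => //; exact: measurable_snd.
  by apply: (measurableT_comp (measurable_dot_vec _)); exact: measurable_fst.
pose prodh w := \prod_(i < n) h (Z i w).
have mprod : measurable_fun [set: T] prodh.
  by apply: measurable_prod => i _; apply: measurableT_comp.
have tail := iid_chernoff ((K + 1) * (n%:R * delta)) iid mh (fun s => ltW (h_gt0 s))
  (sign_model_reference_mgf model beta1 s0 sd).
have mB : measurable [set w | expR ((K + 1) * (n%:R * delta)) <= prodh w].
  have -> : [set w | expR ((K + 1) * (n%:R * delta)) <= prodh w] =
      [set w | - prodh w <= - expR ((K + 1) * (n%:R * delta))].
    by apply/seteqP; split => w /=; rewrite lerN2.
  by apply: measurable_le_set; apply: measurableT_comp.
exists (~` [set w | expR ((K + 1) * (n%:R * delta)) <= prodh w]); split.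
- exact: measurableC.
- rewrite setCK; apply: le_trans tail _; rewrite lee_fin ler_expR -/K.
  lra.
move=> w /negP; rewrite -ltNge => /ltW lt.
rewrite -ler_expR; apply: le_trans lt.
rewrite /logistic_loss expR_sum; apply: ler_prod => i _.
rewrite expR_ge0 /= lnK; first exact: lexx.
by rewrite posrE; exact: (h_gt0 (Z i w)).
Qed.
End GoodEvents.

Section Intersection.
Local Open Scope ereal_scope.
Context d (T : measurableType d) (R : realType) (P : probability T R).

Lemma with_probability_forall (I : finType) (c e : R) (G : I -> set T)
    (E : set T) :
  (0 <= e)%R -> (#|I|%:R <= c)%R -> (forall k, measurable (G k)) ->
  (forall k, P (~` G k) <= e%:E) -> (forall w, (forall k, G k w) -> E w) ->
  with_probability_at_least P (1 - c * e) E.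
Proof.
move=> e0 Ic mG PG GE; exists (~` [set w | exists k, (~` G k) w]).
have mB : measurable [set w | exists k, (~` G k) w].
  by apply: measurable_fin_exists => k; exact: measurableC.
split; first exact: measurableC.
  by move=> w nB; apply: GE => k; apply: contrapT => nG; apply: nB; exists k.
rewrite probability_setC// EFinB leeB//.
apply: le_trans (union_bound (fun k => measurableC (mG k)) PG) _.
by rewrite lee_fin ler_wpM2r.
Qed.
End Intersection.

Lemma sum_indicator_le (R : realType) n (f : 'I_n -> R) (a a' : R) : a <= a' ->
  \sum_(i < n) (nat_of_bool (f i <= a)%R)%:R <=
  \sum_(i < n) (nat_of_bool (f i <= a')%R)%:R :> R.
Proof.
move=> aa; apply: ler_sum => i _; rewrite ler_nat.
by case: (boolP (f i <= a)) => // fa; rewrite (le_trans fa aa).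
Qed.

Theorem theorem2p2p1 (R : realType) :
  exists c c' C : R, [/\ 0 < c, 0 < c' & 0 < C] /\
  forall (n p : nat) (sigma M t : R) (beta : 'rV[R]_p),
    (0 < p)%N -> (p < n)%N -> 0 < sigma -> 0 < M -> 0 < t ->
    l2norm beta = 1 ->
    sigma <= (p%:R * ln n%:R + t) / n%:R ->
    (p%:R * ln n%:R + t) / n%:R <= c ->
    n%:R / (p%:R * ln n%:R + t) <= M ->
  forall (d0 : measure_display) (T0 : measurableType d0)
    (P0 : probability T0 R) (eps : {RV P0 >-> R})
    (z : {RV P0 >-> (p.-tuple R * R)%type}),
    sign_model sigma beta eps z ->
  forall (d : measure_display) (T : measurableType d) (P : probability T R)
    (Z : 'I_n -> {RV P >-> (p.-tuple R * R)%type}),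
    iid_copies z Z ->
  forall gammahat : T -> 'rV[R]_p,
    (forall w, constrained_logistic_solution M (fun i => Z i w) (gammahat w)) ->
  with_probability_at_least P (1 - 6 * expR (- t))
    [set w |
      let tauhat := l2norm (gammahat w) in
      let betahat := tauhat^-1 *: gammahat w in
      l2norm (betahat - beta) <= C * ((p%:R * ln n%:R + t) / n%:R) /\
      c' * (n%:R / (p%:R * ln n%:R + t)) <= tauhat].
Proof.
pose kappa : R := normal_pdf 0 1 2.
have kappa0 : 0 < kappa.
  by rewrite /kappa normal_pdf01E mulr_gt0 ?expR_gt0 ?normal_peak_gt0 ?oner_neq0.
pose l : R := ln (1 + expR (- 1)).
have l0 : 0 < l by rewrite ln_gt0// ltrDl expR_gt0.
(* The constant of reference_loss_event: the reference loss is at most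
   C1 n delta. *)
pose C1 : R := 4 * normal_peak 1 * expR 2 + 1.
have C10 : 0 < C1 by rewrite ltr_wpDl// !mulr_ge0 ?expR_ge0 ?normal_peak_ge0.
(* Every margin event below has probability at least Q delta, hence is hit by
   Q n delta / 4 samples; 28 pays for the union bound over the net, the two
   other terms make the resulting loss exceed C1 n delta. *)
pose Q : R := 28 + 8 * (C1 / l) + 8 * C1.
have C1l : 0 < C1 / l by rewrite divr_gt0.
have Q28 : 28 <= Q by rewrite /Q; lra.
have Q0 : 0 < Q by lra.
have QC1 : C1 < Q / 4 by rewrite /Q; lra.
have QC1l : C1 < Q * l / 4.
  suff : 8 * C1 <= Q * l by lra.
  by rewrite -ler_pdivrMr// -mulrA /Q; lra.
have Qk0 : 0 < Q / kappa by rewrite divr_gt0.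
have Qk30 : 0 < Q / kappa ^+ 3 by rewrite divr_gt0// exprn_gt0.
(* B delta bounds the margins of near samples, net error included, and A delta
   those of misclassified samples. *)
pose B : R := Q / kappa + 1.
have BE : B = Q / kappa + 1 by [].
have B0 : 0 < B by rewrite /B; lra.
pose A : R := Q / kappa ^+ 3 + 1 + B.
have A0 : 0 < A by rewrite /A; lra.
have AB : B <= A - 1 by rewrite /A; lra.
have AQ : Q <= kappa ^+ 3 * A.
  by rewrite -ler_pdivrMl ?exprn_gt0// mulrC /A; lra.
pose m : R := 10 + A + B.
have m0 : 0 < m by rewrite /m; lra.
have m10 : 10 <= m by rewrite /m; lra.
have mA : A <= m by rewrite /m; lra.
have mQ : Q / kappa <= m by rewrite /m BE; lra.
clearbody m A B Q.
exists m^-1, B^-1, (4 * A); split; first by split; rewrite ?invr_gt0// mulr_gt0.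
move=> n p sigma M t beta p0 pn s0 M0 t0 beta1 sd dc dM d0 T0 P0 eps z model.
move=> d T P Z iid gammahat sol.
have n1 : (1 < n)%N by exact: leq_ltn_trans p0 pn.
have n0 : (0 : R) < n%:R by rewrite ltr0n ltnW.
have n2 : 2 <= n%:R :> R by rewrite ler_nat.
set e := p%:R * ln n%:R + t in sd dc dM *.
set delta := e / n%:R in sd dc *.
have lnn0 : 0 <= ln n%:R :> R by rewrite ln_ge0// ler1n ltnW.
have half_ln : 2^-1 <= ln n%:R :> R.
  rewrite -ler_expR lnK ?posrE//; apply: le_trans n2.
  rewrite -[leRHS]invrK -[leLHS]invrK lef_pV2 ?posrE ?invr_gt0 ?expR_gt0//.
  by rewrite -expRN; apply: le_trans (expR_ge1Dx _); lra.
have half_e : 2^-1 <= e.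
  rewrite /e; apply: le_trans half_ln _; rewrite ler_wpDr ?(ltW t0)//.
  by rewrite ler_peMl// ler1n.
have e0 : 0 < e by apply: lt_le_trans half_e; rewrite invr_gt0.
have delta0 : 0 < delta by rewrite divr_gt0.
have en : e = n%:R * delta by rewrite /delta mulrC divfK// gt_eqF.
have dinv : n%:R / e = delta^-1 by rewrite /delta invf_div.
(* The net error of uniform_margin_count is at most delta. *)
have ndelta : (n%:R ^+ 2)^-1 <= delta.
  rewrite /delta expr2 invfM ler_wpM2r ?invr_ge0 ?(ltW n0)//.
  apply: le_trans half_e; rewrite lef_pV2 ?posrE//.
have eE : e = p%:R * ln n%:R + t by [].
clearbody delta e.
have md : m * delta <= 1 by rewrite mulrC -ler_pdivlMr// div1r.
have d10 : delta <= 10^-1 by apply: le_trans dc _; rewrite lef_pV2 ?posrE.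
have Ad : A * delta <= 1 by apply: le_trans md; rewrite ler_wpM2r ?(ltW delta0).
have Qkd : Q / kappa * delta <= 2.
  apply: (@le_trans _ _ 1); last by rewrite ler1n.
  by apply: le_trans md; rewrite ler_wpM2r ?(ltW delta0).
have pn' : (0 < p < n)%N by rewrite p0.
have tdelta : t <= n%:R * delta by rewrite -en eE lerDr mulr_ge0.
have e10 : p%:R * ln n%:R + t <= n%:R / 10 by rewrite -eE en ler_wpM2l// ltW.
have count_size : 4 * (6 * (p%:R * ln n%:R) + t) <= n%:R * (Q * delta).
  rewrite [leRHS]mulrCA -en; apply: (@le_trans _ _ (28 * e)); first by rewrite eE; lra.
  by rewrite ler_wpM2r ?(ltW e0).
have [G1 [mG1 PG1 hG1]] := bounded_design_event model iid pn' e10 t0.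
have [G2 [mG2 PG2 hG2]] := reference_loss_event model iid beta1 s0 sd tdelta.
pose S1 : set 'rV[R]_p := [set b | l2norm b = 1].
have S1q b : S1 b ->
    ((Q * delta)%:E <= P0 (z @^-1` margin_event b (Q / kappa * delta)))%E.
  move=> b1; apply: le_trans (sign_model_near_margin model b1 _).
    by rewrite lee_fin le_eqVlt -/kappa; apply/orP; left; apply/eqP; field; rewrite gt_eqF.
  by rewrite Qkd mulr_ge0// ltW.
have [G3 [mG3 PG3 hG3]] :=
  uniform_margin_count iid pn' (fun b => @unit_coordinate_le1 _ _ b) S1q count_size.
pose S2 : set 'rV[R]_p := [set b | l2norm b = 1 /\ 4 * A * delta <= l2norm (b - beta)].
have S2q b : S2 b -> ((Q * delta)%:E <= P0 (z @^-1` margin_event b (- (A * delta))))%E.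
  move=> [b1 bb]; rewrite -mulrA in bb.
  have Ad01 : 0 <= A * delta <= 1 by rewrite Ad mulr_ge0// ltW.
  apply: le_trans (sign_model_wrong_margin model beta1 s0 b1 Ad01 bb).
  by rewrite lee_fin -/kappa [leRHS]mulrA ler_wpM2r ?(ltW delta0).
have S2c b : S2 b -> forall j, `|b 0 j| <= 1.
  by move=> [b1 _]; exact: unit_coordinate_le1.
have [G4 [mG4 PG4 hG4]] := uniform_margin_count iid pn' S2c S2q count_size.
pose G (k : 'I_4) : set T := nth setT [:: G1; G2; G3; G4] k.
apply: (with_probability_forall (G := G)); first exact: expR_ge0.
- by rewrite card_ord ler_nat.
- by case=> [] [|[|[|[|]]]].
- by case=> [] [|[|[|[|]]]].
move=> w Gw.
have xn := hG1 w (Gw (Ordinal (isT : (0 < 4)%N))).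
have ref := hG2 w (Gw (Ordinal (isT : (1 < 4)%N))).
have near := hG3 w (Gw (Ordinal (isT : (2 < 4)%N))) xn.
have far := hG4 w (Gw (Ordinal (isT : (3 < 4)%N))) xn.
have [_ opt] := sol w.
have ref_feasible : l2norm (delta^-1 *: beta) <= M.
  by rewrite l2normZ beta1 mulr1 ger0_norm ?invr_ge0 ?(ltW delta0)// -dinv.
have low := le_trans (opt _ ref_feasible) ref.
have nd0 : 0 < n%:R * delta by rewrite mulr_gt0.
rewrite dinv; apply: (low_loss_localizes (rho := B^-1 * delta^-1)
  (h := (A - 1) * delta) (k0 := n%:R * (Q * delta) / 4) beta1 _ _ _ _ _ _ low).
- by rewrite mulr_gt0 ?invr_gt0.
- by rewrite mulr_ge0 ?(ltW delta0)// (le_trans (ltW B0) AB).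
- have -> : n%:R * (Q * delta) / 4 * ln (1 + expR (- 1)) = Q * l / 4 * (n%:R * delta).
    by rewrite -/l; field.
  by rewrite ltr_pM2r.
- have rh : 1 <= B^-1 * delta^-1 * ((A - 1) * delta).
    have -> : B^-1 * delta^-1 * ((A - 1) * delta) = (A - 1) / B.
      by field; rewrite !gt_eqF.
    by rewrite ler_pdivlMr// mul1r.
  apply: (@lt_le_trans _ _ (n%:R * (Q * delta) / 4 * 1)); last first.
    by rewrite ler_wpM2l// divr_ge0// mulr_ge0 ?(ltW n0)// mulr_ge0 ?ltW.
  have -> : n%:R * (Q * delta) / 4 * 1 = Q / 4 * (n%:R * delta) by field.
  by rewrite ltr_pM2r.
- move=> b b1; apply: le_trans (near b b1) _; apply: sum_indicator_le.
  rewrite [leRHS]invfM !invrK; apply: (@le_trans _ _ (Q / kappa * delta + delta)).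
    by rewrite lerD2l.
  by rewrite BE [leRHS]mulrDl mul1r.
- move=> b b1 bb; apply: le_trans (far b (conj b1 bb)) _; apply: sum_indicator_le.
  by rewrite mulrBl mul1r opprB [leRHS]addrC lerD2l.
Qed.
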